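(* Let $p:\mathbb{E}\to\mathbb{B}$ be a fibred type-theoretic fibration category. Let $u:\tilde U\to U$ be a fibration in $\mathbb{B}$ and $v:\tilde V\to V$ a fibration in the fiber $\mathbb{E}_1$ over the terminal object. For $I\in\mathbb{B}$ let $v_I:\tilde V_I\to V_I$ be the reindexing of $v$ along the unique morphism $I\to1$. Suppose the following conditions hold. \begin{enumerate} \item The fibration $u$ is a universe in $\mathbb{B}$, and for every $I\in\mathbb{B}$ the fibration $v_I$ is a universe in $\mathbb{E}_I$. \item The fibration $u_*v_{\tilde U}:u_*\tilde V_{\tilde U}\to u_*V_{\tilde U}$ is ($v_U$-)small in $\mathbb{E}_U$. \end{enumerate} Then $p$ has a fibred universe $w:\tilde W\to W$ above $u$, defined as $W=u_*V_{\tilde U}$ and $\tilde W=\varepsilon^*\tilde V_{\tilde U}$, where $\varepsilon:u^*u_*V_{\tilde U}\to V_{\tilde U}$ is the counit of the adjunction $u^*\dashv u_*$, $\varepsilon^*\tilde V_{\tilde U}\to u^*u_*V_{\tilde U}$ is the pullback of $v_{\tilde U}$ along $\varepsilon$ in $\mathbb{E}_{\tilde U}$, and $w$ is the composite $\varepsilon^*\tilde V_{\tilde U}\to u^*u_*V_{\tilde U}\to u_*V_{\tilde U}$ of this pullback with the cartesian morphism above $u$.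
   Context: A morphism $i:A\to B$ has the left lifting property with respect to $q:C\to D$ if for all $f:A\to C$, $g:B\to D$ with $qf=gi$ there is $h:B\to C$ with $hi=f$ and $qh=g$. A type-theoretic fibration category is a category $\mathbb{C}$ with a terminal object $1$ and a subcategory whose morphisms are called fibrations, such that (an acyclic cofibration being a morphism with the left lifting property with respect to all fibrations): (i) all isomorphisms and all morphisms with codomain $1$ are fibrations; (ii) pullbacks of fibrations along arbitrary morphisms exist and are fibrations; (iii) every morphism factors as an acyclic cofibration followed by a fibration; (iv) for any fibrations $f:A\to B$ and $g:B\to C$ there is a fibration $\Pi_gf:\Pi_gA\to C$, called a dependent product of $f$ along $g$, with a natural bijection $(\mathbb{C}/C)(h,\Pi_gf)\cong(\mathbb{C}/B)(g^*h,f)$ for all $h:X\to C$. A type-theoretic functor preserves terminal objects, fibrations, pullbacks of fibrations, acyclic cofibrations and dependent products. A fibred category $p:\mathbb{E}\to\mathbb{B}$ is a Grothendieck fibration; $\mathbb{E}_I$ is the fiber over $I$, and a morphism $f$ is above $s$ if $pf=s$. A fibred type-theoretic fibration category is a fibred category $p:\mathbb{E}\to\mathbb{B}$ such that: (1) $\mathbb{E}$ and $\mathbb{B}$ are type-theoretic fibration categories and $p$ is a type-theoretic functor; (2) every cartesian morphism above a fibration is a fibration; (3) if $g:A\to C$ is a fibration in $\mathbb{E}$, $pg=t\circ s$ with $s:pA\to J$ a fibration and $t:J\to pC$, then the induced morphism $A\to t^*C$ above $s$ is a fibration; (4) every cartesian morphism above an acyclic cofibration is an acyclic cofibration. In this case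 each fiber $\mathbb{E}_I$ is a type-theoretic fibration category whose fibrations are the morphisms of $\mathbb{E}_I$ that are fibrations in $\mathbb{E}$, and for each fibration $s:I\to J$ in $\mathbb{B}$ the reindexing functor $s^*:\mathbb{E}_J\to\mathbb{E}_I$ has a right adjoint $s_*$ preserving fibrations. A fibration $u:\tilde U\to U$ in a type-theoretic fibration category is a universe if, calling pullbacks of $u$ ($u$-)small fibrations: (a) small fibrations are closed under composition and contain the identities; (b) if $f:A\to B$ and $g:B\to C$ are small fibrations, so is $\Pi_gf:\Pi_gA\to C$; (c) if $A\to C$ and $B\to C$ are small fibrations, any morphism $A\to B$ over $C$ factors as an acyclic cofibration followed by a small fibration. A fibred universe in $p$ is a fibration $w:\tilde W\to W$ in $\mathbb{E}$ such that: (1) $w$ and $pw$ are universes in $\mathbb{E}$ and $\mathbb{B}$ respectively; (2) for a $w$-small fibration $f:A\to B$ and a pullback square exhibiting $pf$ as a pullback of $pw$ along $h:pB\to pW$ with upper morphism $k:pA\to p\tilde W$, there is a pullback square exhibiting $f$ as a pullback of $w$ along some $\bar h:B\to W$ above $h$ with upper morphism $\bar k:A\to\tilde W$ above $k$; (3) every cartesian morphism above a $pw$-small fibration is a $w$-small fibration; (4) for every $w$-small fibration $g:A\to C$, $pw$-small fibration $s:pA\to J$ and arbitrary morphism $t:J\to pC$ with $t\circ s=pg$, the induced morphism $A\to t^*C$ (above $s$) is a $w$-small fibration. That $w$ is above $u$ means $pw=u$. *)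

(* Defs.v *)
From Stdlib Require Import ssreflect ssrfun.
From Stdlib Require Import Classical ClassicalEpsilon ProofIrrelevance.

Set Implicit Arguments.
Unset Strict Implicit.
Unset Printing Implicit Defensive.

(** * Categories, functors, adjunctions *)

Declare Scope cat_scope.
Delimit Scope cat_scope with cat.
Local Open Scope cat_scope.

Record Category := {
  Ob :> Type;
  Hom : Ob -> Ob -> Type;
  idm : forall X, Hom X X;
  comp : forall X Y Z, Hom Y Z -> Hom X Y -> Hom X Z;
  comp_idl : forall X Y (f : Hom X Y), comp (idm Y) f = f;
  comp_idr : forall X Y (f : Hom X Y), comp f (idm X) = f;
  comp_assoc : forall X Y Z T (h : Hom Z T) (g : Hom Y Z) (f : Hom X Y),
    comp h (comp g f) = comp (comp h g) f }.

Arguments Hom {_} _ _.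
Arguments idm {_} _.
Arguments comp {_ _ _ _} _ _.

Notation "X ~> Y" := (Hom X Y) (at level 90, no associativity) : cat_scope.
Notation "g ∘ f" := (comp g f) (at level 40, left associativity) : cat_scope.

Record Functor (C D : Category) := {
  fobj :> C -> D;
  fmap : forall X Y, (X ~> Y) -> (fobj X ~> fobj Y);
  fmap_id : forall X, fmap (idm X) = idm (fobj X);
  fmap_comp : forall X Y Z (g : Y ~> Z) (f : X ~> Y),
    fmap (g ∘ f) = fmap g ∘ fmap f }.

Arguments fmap {_ _} _ {_ _} _.

Record Adjunction (C D : Category) (F : Functor C D) (G : Functor D C) := {
  adj_unit : forall X : C, X ~> G (F X);
  adj_counit : forall Y : D, F (G Y) ~> Y;
  adj_unit_natural : forall (X X' : C) (f : X ~> X'),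
    adj_unit X' ∘ f = fmap G (fmap F f) ∘ adj_unit X;
  adj_counit_natural : forall (Y Y' : D) (g : Y ~> Y'),
    adj_counit Y' ∘ fmap F (fmap G g) = g ∘ adj_counit Y;
  triangle_left : forall X : C, adj_counit (F X) ∘ fmap F (adj_unit X) = idm (F X);
  triangle_right : forall Y : D, fmap G (adj_counit Y) ∘ adj_unit (G Y) = idm (G Y) }.

Arguments adj_unit {_ _ _ _} _ _.
Arguments adj_counit {_ _ _ _} _ _.

Section CategoryNotions.
Variable C : Category.

Definition is_iso (X Y : C) (f : X ~> Y) : Prop :=
  exists g : Y ~> X, g ∘ f = idm X /\ f ∘ g = idm Y.

Definition is_terminal (T : C) : Prop := forall X : C, exists! f : X ~> T, True.

(** The square
<<
      P --top--> A
      |          |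
     left        f
      v          v
      B ---h---> D
>>
    exhibits [left] as a pullback of [f] along [h]. *)
Definition is_pullback (P A B D : C) (top : P ~> A) (left : P ~> B)
    (f : A ~> D) (h : B ~> D) : Prop :=
  f ∘ top = h ∘ left /\
  forall (X : C) (a : X ~> A) (b : X ~> B), f ∘ a = h ∘ b ->
    exists! m : X ~> P, top ∘ m = a /\ left ∘ m = b.

Definition lifts_against (A B X Y : C) (i : A ~> B) (q : X ~> Y) : Prop :=
  forall (f : A ~> X) (g : B ~> Y), q ∘ f = g ∘ i ->
    exists h : B ~> X, h ∘ i = f /\ q ∘ h = g.

(** The hom-set [(C/D)(h, k)]. *)
Definition SliceHom (D X Y : C) (h : X ~> D) (k : Y ~> D) : Type :=
  {m : X ~> Y | k ∘ m = h}.

(** Functions [(C/D)(h, pi) -> (C/B)(g^*h, f)] for all [h : X ~> D] and all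
    pullbacks [b = g^*h : Q ~> B] of [h] along [g]. *)
Definition Transposition (A B D P : C) (f : A ~> B) (g : B ~> D) (pi : P ~> D) : Type :=
  forall (X : C) (h : X ~> D) (Q : C) (b : Q ~> B) (q : Q ~> X),
    is_pullback b q g h -> SliceHom h pi -> SliceHom b f.

(** Naturality is with respect to [t : h ~> h'] in [C/D] and to the morphism
    [g^*t = r : g^*h ~> g^*h'] that it induces on the pullbacks. *)
Definition is_natural_bijection (A B D P : C) (f : A ~> B) (g : B ~> D) (pi : P ~> D)
    (phi : Transposition f g pi) : Prop :=
  (forall X (h : X ~> D) Q (b : Q ~> B) (q : Q ~> X) (sq : is_pullback b q g h),
     bijective (phi X h Q b q sq)) /\
  (forall X (h : X ~> D) Q (b : Q ~> B) (q : Q ~> X) (sq : is_pullback b q g h)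
          X' (h' : X' ~> D) Q' (b' : Q' ~> B) (q' : Q' ~> X') (sq' : is_pullback b' q' g h')
          (t : X ~> X') (r : Q ~> Q'),
     h' ∘ t = h -> q' ∘ r = t ∘ q -> b' ∘ r = b ->
     forall (k : SliceHom h' pi) (kt : SliceHom h pi),
       proj1_sig kt = proj1_sig k ∘ t ->
       proj1_sig (phi X h Q b q sq kt) = proj1_sig (phi X' h' Q' b' q' sq' k) ∘ r).

(** [pi : P ~> D] is a dependent product of [f] along [g]. *)
Definition is_dependent_product (A B D P : C) (f : A ~> B) (g : B ~> D) (pi : P ~> D) : Prop :=
  exists phi : Transposition f g pi, is_natural_bijection phi.

End CategoryNotions.

(** * Type-theoretic fibration categories *)

Definition MorClass (C : Category) := forall X Y : C, (X ~> Y) -> Prop.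

Definition acyclic_cofibration (C : Category) (fib : MorClass C) : MorClass C :=
  fun A B i => forall (X Y : C) (q : X ~> Y), fib X Y q -> lifts_against i q.

Record TTFC := {
  ttfc_cat :> Category;
  one : ttfc_cat;
  bang : forall X : ttfc_cat, X ~> one;
  bang_unique : forall (X : ttfc_cat) (f : X ~> one), f = bang X;
  fib : MorClass ttfc_cat;
  fib_comp : forall (X Y Z : ttfc_cat) (g : Y ~> Z) (f : X ~> Y),
    fib g -> fib f -> fib (g ∘ f);
  fib_iso : forall (X Y : ttfc_cat) (f : X ~> Y), is_iso f -> fib f;
  fib_one : forall (X : ttfc_cat) (f : X ~> one), fib f;
  fib_pullback_exists : forall (A B D : ttfc_cat) (f : A ~> D) (h : B ~> D), fib f ->
    exists (P : ttfc_cat) (top : P ~> A) (left : P ~> B), is_pullback top left f h;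
  fib_pullback : forall (P A B D : ttfc_cat) (top : P ~> A) (left : P ~> B)
      (f : A ~> D) (h : B ~> D),
    fib f -> is_pullback top left f h -> fib left;
  fib_factorization : forall (X Y : ttfc_cat) (f : X ~> Y),
    exists (Z : ttfc_cat) (i : X ~> Z) (q : Z ~> Y),
      acyclic_cofibration fib i /\ fib q /\ q ∘ i = f;
  fib_dependent_product : forall (A B D : ttfc_cat) (f : A ~> B) (g : B ~> D),
    fib f -> fib g ->
    exists (P : ttfc_cat) (pi : P ~> D), fib pi /\ is_dependent_product f g pi }.

Arguments one _ : clear implicits.
Arguments bang _ _ : clear implicits.
Arguments fib {_} [X Y] _.

(** Preservation of a dependent product means that the image under [F] is a
    dependent product whose transposition is compatible with the given one,
    equivalently that the canonical comparison morphism is invertible; a mere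
    isomorphism [F (Pi_g f) ~ Pi_(F g) (F f)] is not enough. *)
Record is_type_theoretic_functor (C D : TTFC) (F : Functor C D) : Prop := {
  ttf_one : is_terminal (F (one C));
  ttf_fib : forall (X Y : C) (f : X ~> Y), fib f -> fib (fmap F f);
  ttf_pullback : forall (P A B E : C) (top : P ~> A) (left : P ~> B)
      (f : A ~> E) (h : B ~> E),
    fib f -> is_pullback top left f h ->
    is_pullback (fmap F top) (fmap F left) (fmap F f) (fmap F h);
  ttf_acyclic_cofibration : forall (X Y : C) (i : X ~> Y),
    acyclic_cofibration (@fib C) i -> acyclic_cofibration (@fib D) (fmap F i);
  ttf_dependent_product : forall (A B E P : C) (f : A ~> B) (g : B ~> E) (pi : P ~> E)
      (phi : Transposition f g pi),
    fib f -> fib g -> is_natural_bijection phi ->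
    exists psi : Transposition (fmap F f) (fmap F g) (fmap F pi),
      is_natural_bijection psi /\
      forall X (h : X ~> E) Q (b : Q ~> B) (q : Q ~> X) (sq : is_pullback b q g h)
        (Fsq : is_pullback (fmap F b) (fmap F q) (fmap F g) (fmap F h))
        (k : SliceHom h pi) (Fk : SliceHom (fmap F h) (fmap F pi)),
        proj1_sig Fk = fmap F (proj1_sig k) ->
        proj1_sig (psi _ _ _ _ _ Fsq Fk) = fmap F (proj1_sig (phi _ _ _ _ _ sq k)) }.

(** ** Universes

    These notions only mention a category and a class of fibrations, so that
    they apply directly to the fibers of a fibred category. *)

Definition small (C : Category) (Ut U : C) (u : Ut ~> U) : MorClass C :=
  fun A B f => exists (k : A ~> Ut) (h : B ~> U), is_pullback k f u h.

Record is_universe (C : Category) (fib : MorClass C) (Ut U : C) (u : Ut ~> U) : Prop := {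
  univ_fib : fib _ _ u;
  univ_id : forall A : C, small u (idm A);
  univ_comp : forall (A B D : C) (f : A ~> B) (g : B ~> D),
    small u f -> small u g -> small u (g ∘ f);
  univ_dependent_product : forall (A B D P : C) (f : A ~> B) (g : B ~> D) (pi : P ~> D),
    small u f -> small u g -> is_dependent_product f g pi -> small u pi;
  univ_factorization : forall (A B D : C) (a : A ~> D) (b : B ~> D) (m : A ~> B),
    small u a -> small u b -> b ∘ m = a ->
    exists (Z : C) (i : A ~> Z) (q : Z ~> B),
      acyclic_cofibration fib i /\ small u q /\ q ∘ i = m }.

(** * Fibred categories *)

(** Equality of morphisms whose domains and codomains are only
    propositionally equal. *)
Inductive arr_eq (C : Category) (X Y : C) (f : X ~> Y) :
    forall X' Y' : C, (X' ~> Y') -> Prop :=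
  arr_refl : @arr_eq C X Y f X Y f.

Arguments arr_eq {C X Y} f {X' Y'} _.

Lemma arr_eq_comp (C : Category) (X Y Z X' Y' Z' : C)
    (f : X ~> Y) (g : Y ~> Z) (f' : X' ~> Y') (g' : Y' ~> Z') :
  arr_eq f f' -> arr_eq g g' -> arr_eq (g ∘ f) (g' ∘ f').
Proof.
move=> Hf Hg.
have H : forall e : Y = Y', arr_eq (g ∘ f) (g' ∘ eq_rect Y (Hom X) f Y' e).
  by destruct Hg => e; rewrite (proof_irrelevance _ e erefl); apply: arr_refl.
by destruct Hf; apply: (H erefl).
Qed.

Lemma arr_eq_same (C : Category) (X Y : C) (f f' : X ~> Y) : arr_eq f f' -> f = f'.
Proof.
have H X' Y' (g : X' ~> Y') : arr_eq f g -> forall (eX : X = X') (eY : Y = Y'),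
    eq_rect X (fun Z => Hom Z Y') (eq_rect Y (Hom X) f Y' eY) X' eX = g.
  case=> eX eY.
  by rewrite (proof_irrelevance _ eX erefl) (proof_irrelevance _ eY erefl).
by move=> Hf; apply: (H _ _ _ Hf erefl erefl).
Qed.

Lemma arr_eq_factor (C : Category) (X Y Z : C) (e : Z = X) (f : X ~> Y) (g : Z ~> Y) :
  arr_eq g f -> exists t : Z ~> X, arr_eq t (idm X) /\ f ∘ t = g.
Proof.
destruct e => H; exists (idm _); split; first exact: arr_refl.
by rewrite comp_idr (arr_eq_same H).
Qed.

Lemma arr_eq_id_unique (C : Category) (X Z : C) (e : Z = X) (t t' : Z ~> X) :
  arr_eq t (idm X) -> arr_eq t' (idm X) -> t' = t.
Proof. by destruct e => /arr_eq_same -> /arr_eq_same ->. Qed.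

Section Fibred.
Variables (E B : Category) (p : Functor E B).

Definition above (X Y : E) (f : X ~> Y) (I J : B) (s : I ~> J) : Prop :=
  arr_eq (fmap p f) s.

Definition is_cartesian (X Y : E) (f : X ~> Y) : Prop :=
  forall (Z : E) (g : Z ~> Y) (t : p Z ~> p X), fmap p f ∘ t = fmap p g ->
    exists! h : Z ~> X, fmap p h = t /\ f ∘ h = g.

Definition is_fibred : Prop :=
  forall (I : B) (Y : E) (s : I ~> p Y),
    exists (X : E) (f : X ~> Y), above f s /\ is_cartesian f.

(** ** Fibers *)

Definition FiberOb (I : B) : Type := {X : E | p X = I}.

Definition FiberHom (I : B) (X Y : FiberOb I) : Type :=
  {f : proj1_sig X ~> proj1_sig Y | above f (idm I)}.

Lemma fiber_hom_eq (I : B) (X Y : FiberOb I) (f g : FiberHom X Y) :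
  proj1_sig f = proj1_sig g -> f = g.
Proof.
destruct f as [f Hf], g as [g Hg] => /= e; subst.
by rewrite (proof_irrelevance _ Hf Hg).
Qed.

Lemma fiber_id_above (I : B) (X : FiberOb I) : above (idm (proj1_sig X)) (idm I).
Proof. by destruct X as [X []]; rewrite /above fmap_id; apply: arr_refl. Qed.

Lemma fiber_comp_above (I J K : B) (s : I ~> J) (t : J ~> K) (X Y Z : E)
    (g : Y ~> Z) (f : X ~> Y) : above g t -> above f s -> above (g ∘ f) (t ∘ s).
Proof. by move=> Hg Hf; rewrite /above fmap_comp; apply: arr_eq_comp. Qed.

Definition fiber_id (I : B) (X : FiberOb I) : FiberHom X X :=
  exist _ (idm (proj1_sig X)) (fiber_id_above X).

Lemma fiber_hom_comp_above (I : B) (X Y Z : FiberOb I) (g : FiberHom Y Z) (f : FiberHom X Y) :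
  above (proj1_sig g ∘ proj1_sig f) (idm I).
Proof.
by have := fiber_comp_above (proj2_sig g) (proj2_sig f); rewrite comp_idl.
Qed.

Definition fiber_comp (I : B) (X Y Z : FiberOb I) (g : FiberHom Y Z) (f : FiberHom X Y) :
    FiberHom X Z :=
  exist _ (proj1_sig g ∘ proj1_sig f) (fiber_hom_comp_above g f).

Definition Fiber (I : B) : Category.
Proof.
refine (@Build_Category (FiberOb I) (@FiberHom I) (@fiber_id I) (@fiber_comp I) _ _ _).
- by move=> *; apply: fiber_hom_eq; apply: comp_idl.
- by move=> *; apply: fiber_hom_eq; apply: comp_idr.
- by move=> *; apply: fiber_hom_eq; apply: comp_assoc.
Defined.

(** ** Reindexing *)

Record CartesianLift (I J : B) (s : I ~> J) (Y : Fiber J) := {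
  lift_ob : Fiber I;
  lift_map : proj1_sig lift_ob ~> proj1_sig Y;
  lift_above : above lift_map s;
  lift_cartesian : is_cartesian lift_map }.

Definition Cleavage : Type := forall (I J : B) (s : I ~> J) (Y : Fiber J), CartesianLift s Y.

Lemma cartesian_lift_factor (I J : B) (s : I ~> J) (Y : Fiber J) (L : CartesianLift s Y)
    (Z : Fiber I) (g : proj1_sig Z ~> proj1_sig Y) : above g s ->
  exists! h : Hom (c := Fiber I) Z (lift_ob L), lift_map L ∘ proj1_sig h = g.
Proof.
destruct L as [[X eX] f fs fc] => /=; cbn in f, fc, fs, g |- *.
destruct Z as [Z eZ], Y as [Y eY]; cbn in *.
move: fs; rewrite /above => fs gs; destruct eX.
destruct eY.
move: (arr_eq_same fs) => e; subst s.
have [t [tE tg]] := arr_eq_factor eZ gs.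
have [h [[ht hg] hu]] := fc Z g t tg.
have ha : above h (idm (p X)) by rewrite /above ht.
exists (exist _ h ha); split => //.
move=> [h' h'a] /= h'g; apply: fiber_hom_eq => /=; apply: hu; split => //.
exact: arr_eq_id_unique eZ _ _ tE h'a.
Qed.

Lemma reindex_map_above (I J : B) (s : I ~> J) (Y Y' : Fiber J) (L : CartesianLift s Y)
    (m : Y ~> Y') : above (proj1_sig m ∘ lift_map L) s.
Proof.
by have := fiber_comp_above (proj2_sig m) (lift_above L); rewrite comp_idl.
Qed.

Variable cl : Cleavage.

(** [s^*m] is the unique morphism of the fiber such that
    [lift_map ∘ s^*m = m ∘ lift_map]. *)
Definition reindex_map_sig (I J : B) (s : I ~> J) (Y Y' : Fiber J) (m : Y ~> Y') :=
  constructive_indefinite_description _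
    (cartesian_lift_factor (cl s Y') (reindex_map_above (cl s Y) m)).

Definition reindex (I J : B) (s : I ~> J) : Functor (Fiber J) (Fiber I).
Proof.
refine (@Build_Functor (Fiber J) (Fiber I) (fun Y => lift_ob (cl s Y))
  (fun Y Y' m => proj1_sig (reindex_map_sig s m)) _ _).
- move=> Y; case: (reindex_map_sig s (idm Y)) => h [hE hu] /=.
  by apply: hu; rewrite /= comp_idr comp_idl.
- move=> X Y Z g f.
  case: (reindex_map_sig s (g ∘ f)) => h [hE hu] /=.
  case: (reindex_map_sig s g) => h1 [h1E _] /=.
  case: (reindex_map_sig s f) => h2 [h2E _] /=.
  by apply: hu; rewrite /= comp_assoc h1E -comp_assoc h2E comp_assoc.
Defined.

End Fibred.

Arguments Fiber {E B} p I.
Arguments Cleavage {E B} p.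
Arguments reindex {E B p} cl {I J} s.

Definition fiber_fib (E B : TTFC) (p : Functor E B) (I : B) : MorClass (Fiber p I) :=
  fun X Y f => fib (proj1_sig f).

Arguments fiber_fib {E B} p I.

(** * Fibred type-theoretic fibration categories and fibred universes *)

(** In [fttfc_induced], [c : D ~> C] is a cartesian lift of [t], so [D] is
    [t^*C] and [m] is the induced morphism [A ~> t^*C]. *)
Record is_fibred_TTFC (E B : TTFC) (p : Functor E B) : Prop := {
  fttfc_fibred : is_fibred p;
  fttfc_functor : is_type_theoretic_functor p;
  fttfc_cartesian_fib : forall (X Y : E) (f : X ~> Y),
    is_cartesian p f -> fib (fmap p f) -> fib f;
  fttfc_induced : forall (A C : E) (g : A ~> C) (J : B) (s : p A ~> J) (t : J ~> p C),
    fib g -> fmap p g = t ∘ s -> fib s ->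
    forall (D : E) (c : D ~> C) (m : A ~> D),
      is_cartesian p c -> above p c t -> above p m s -> c ∘ m = g -> fib m;
  fttfc_cartesian_acyclic_cofibration : forall (X Y : E) (f : X ~> Y),
    is_cartesian p f -> acyclic_cofibration (@fib B) (fmap p f) ->
    acyclic_cofibration (@fib E) f }.

Record is_fibred_universe (E B : TTFC) (p : Functor E B) (Wt W : E) (w : Wt ~> W) : Prop := {
  funiv_fib : fib w;
  funiv_total : is_universe (@fib E) w;
  funiv_base : is_universe (@fib B) (fmap p w);
  funiv_lift : forall (X Y : E) (f : X ~> Y), small w f ->
    forall (h : p Y ~> p W) (k : p X ~> p Wt),
      is_pullback k (fmap p f) (fmap p w) h ->
      exists (hbar : Y ~> W) (kbar : X ~> Wt),
        fmap p hbar = h /\ fmap p kbar = k /\ is_pullback kbar f w hbar;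
  funiv_cartesian : forall (X Y : E) (f : X ~> Y),
    is_cartesian p f -> small (fmap p w) (fmap p f) -> small w f;
  funiv_induced : forall (A C : E) (g : A ~> C) (J : B) (s : p A ~> J) (t : J ~> p C),
    small w g -> small (fmap p w) s -> t ∘ s = fmap p g ->
    forall (D : E) (c : D ~> C) (m : A ~> D),
      is_cartesian p c -> above p c t -> above p m s -> c ∘ m = g -> small w m }.

(* Main.v *)
From Stdlib Require Import ssreflect ssrfun ClassicalEpsilon ProofIrrelevance.
Require Import Defs.

(** Small fibrations for [w] are recognised fibrewise: factoring [f = d ∘ f'] with [d]
    cartesian and [f'] vertical up to isomorphism, [f] is [w]-small iff [p d] is [u]-small
    and [f'] is a pullback of [v].  A pullback square of [p d] against [u] and a classifying
    map of [f'] combine, through the universal property of [u_* V] over every base change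
    (Beck-Chevalley), into a classifying map of [f].  That property is not part of the
    adjunction [u^* -| u_*]; it comes from dependent products in [E], preserved by [p], of
    which [u_* V] is a retract.

    Composition is then immediate.  For factorizations, the vertical part is extended along
    a cartesian acyclic cofibration, since [V] is fibrant, and then factored in a fibre.
    A dependent product is reduced by base change along the evaluation map to the case
    [f] vertical, where [Pi_(d g') = Pi_d Pi_g'], with [Pi_g'] computed in a fibre and
    [Pi_d f] a pullback of [u_* v].

    To avoid transports along equalities of objects, strict fibres are used only at the
    boundary with the statement; elsewhere "vertical" means sent by [p] to an isomorphism. *)

Set Implicit Arguments.
Unset Strict Implicit.
Unset Printing Implicit Defensive.

Local Open Scope cat_scope.

(** * Pullbacks and dependent products in a category *)

Lemma comp_eql (C : Category) (X Y Z T : C) (g : Y ~> Z) (f : X ~> Y) (h : X ~> Z) :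
  g ∘ f = h -> forall k : Z ~> T, k ∘ g ∘ f = k ∘ h.
Proof. by move=> <- k; rewrite comp_assoc. Qed.

Lemma comp_eql3 (C : Category) (X Y Y' Z T : C) (g : Y' ~> Z) (g' : Y ~> Y') (f : X ~> Y)
    (h : X ~> Z) :
  g ∘ g' ∘ f = h -> forall k : Z ~> T, k ∘ g ∘ g' ∘ f = k ∘ h.
Proof. by move=> <- k; rewrite !comp_assoc. Qed.

(* Rewrites with [e] inside a left-associated composite. *)
Ltac crw e :=
  rewrite ?comp_assoc;
  first [rewrite e | rewrite (comp_eql e) | rewrite (comp_eql3 e)];
  rewrite ?comp_assoc ?comp_idl ?comp_idr.
Ltac crwl e := crw (Logic.eq_sym e).

Section Isomorphisms.
Variable C : Category.

Lemma is_iso_id (X : C) : is_iso (idm X).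
Proof. by exists (idm X); rewrite comp_idl. Qed.

Lemma is_iso_comp (X Y Z : C) (g : Y ~> Z) (f : X ~> Y) :
  is_iso g -> is_iso f -> is_iso (g ∘ f).
Proof.
move=> [g' [g1 g2]] [f' [f1 f2]]; exists (f' ∘ g'); split.
- by crw g1; crw f1.
- by crw f2; crw g2.
Qed.

Lemma is_iso_cancel_l (X Y Z : C) (g : Y ~> Z) (f : X ~> Y) :
  is_iso g -> is_iso (g ∘ f) -> is_iso f.
Proof.
move=> [g' [g1 g2]] [i [i1 i2]]; exists (i ∘ g); split.
- by rewrite -i1; rewrite !comp_assoc.
- have e : f = g' ∘ (g ∘ f) by rewrite comp_assoc g1 comp_idl.
  by rewrite {1}e !comp_assoc; crw i2.
Qed.

Lemma iso_mono (X Y Z : C) (g : Y ~> Z) (f f' : X ~> Y) :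
  is_iso g -> g ∘ f = g ∘ f' -> f = f'.
Proof.
move=> [g' [g1 _]] e.
by rewrite -(comp_idl f) -(comp_idl f') -g1 -!comp_assoc e.
Qed.

End Isomorphisms.

Lemma fmap_iso (C D : Category) (F : Functor C D) (X Y : C) (f : X ~> Y) :
  is_iso f -> is_iso (fmap F f).
Proof.
by move=> [g [e1 e2]]; exists (fmap F g); rewrite -!fmap_comp e1 e2 !fmap_id.
Qed.

(** * Pasting, cancellation and uniqueness of pullback squares *)

Section Pullbacks.
Variable C : Category.

Lemma pb_comm (P A B D : C) (t : P ~> A) (l : P ~> B) (f : A ~> D) (h : B ~> D) :
  is_pullback t l f h -> f ∘ t = h ∘ l.
Proof. by case. Qed.

Lemma pb_ex (P A B D : C) (t : P ~> A) (l : P ~> B) (f : A ~> D) (h : B ~> D) :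
  is_pullback t l f h -> forall (X : C) (a : X ~> A) (b : X ~> B), f ∘ a = h ∘ b ->
  exists m : X ~> P, t ∘ m = a /\ l ∘ m = b.
Proof. by move=> [_ H] X a b /H [m [mE _]]; exists m. Qed.

Lemma pb_eq (P A B D : C) (t : P ~> A) (l : P ~> B) (f : A ~> D) (h : B ~> D) :
  is_pullback t l f h -> forall (X : C) (m m' : X ~> P),
  t ∘ m = t ∘ m' -> l ∘ m = l ∘ m' -> m = m'.
Proof.
move=> [e H] X m m' et el.
have [|n [_ nu]] := H X (t ∘ m) (l ∘ m); first by rewrite !comp_assoc e.
by rewrite -(nu m) // -(nu m').
Qed.

Lemma pb_intro (P A B D : C) (t : P ~> A) (l : P ~> B) (f : A ~> D) (h : B ~> D) :
  f ∘ t = h ∘ l ->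
  (forall (X : C) (a : X ~> A) (b : X ~> B), f ∘ a = h ∘ b ->
     exists m : X ~> P, t ∘ m = a /\ l ∘ m = b) ->
  (forall (X : C) (m m' : X ~> P), t ∘ m = t ∘ m' -> l ∘ m = l ∘ m' -> m = m') ->
  is_pullback t l f h.
Proof.
move=> e ex uq; split=> // X a b /ex [m [m1 m2]]; exists m; split=> // m' [m1' m2'].
by apply: uq; [rewrite m1 m1' | rewrite m2 m2'].
Qed.

Lemma pb_sym (P A B D : C) (t : P ~> A) (l : P ~> B) (f : A ~> D) (h : B ~> D) :
  is_pullback t l f h -> is_pullback l t h f.
Proof.
move=> H; apply: pb_intro.
- by rewrite (pb_comm H).
- by move=> X a b e; have [m [m1 m2]] := pb_ex H (Logic.eq_sym e); exists m.
- by move=> X m m' e1 e2; apply: (pb_eq H).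
Qed.

Lemma pb_hcomp (P2 P1 A B2 B1 D : C) (t1 : P1 ~> A) (l1 : P1 ~> B1) (f : A ~> D)
    (h1 : B1 ~> D) (t2 : P2 ~> P1) (l2 : P2 ~> B2) (h2 : B2 ~> B1) :
  is_pullback t1 l1 f h1 -> is_pullback t2 l2 l1 h2 ->
  is_pullback (t1 ∘ t2) l2 f (h1 ∘ h2).
Proof.
move=> H1 H2; apply: pb_intro.
- by crw (pb_comm H1); crw (pb_comm H2).
- move=> X a b e.
  have [|m [m1 m2]] := pb_ex H1 (a := a) (b := h2 ∘ b); first by rewrite comp_assoc.
  have [n [n1 n2]] := pb_ex H2 m2.
  by exists n; split=> //; crw n1.
- move=> X m m' e1 e2; apply: (pb_eq H2) => //; apply: (pb_eq H1).
    by rewrite !comp_assoc.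
  by crw (pb_comm H2); rewrite -!comp_assoc e2.
Qed.

Lemma pb_hcancel (P2 P1 A B2 B1 D : C) (t1 : P1 ~> A) (l1 : P1 ~> B1) (f : A ~> D)
    (h1 : B1 ~> D) (t2 : P2 ~> P1) (l2 : P2 ~> B2) (h2 : B2 ~> B1) :
  is_pullback t1 l1 f h1 -> l1 ∘ t2 = h2 ∘ l2 ->
  is_pullback (t1 ∘ t2) l2 f (h1 ∘ h2) -> is_pullback t2 l2 l1 h2.
Proof.
move=> H1 e2 H; apply: pb_intro => //.
- move=> X a b e.
  have [|m [m1 m2]] := pb_ex H (a := t1 ∘ a) (b := b).
    by crw (pb_comm H1); crw e.
  exists m; split=> //; apply: (pb_eq H1); first by rewrite !comp_assoc.
  by rewrite comp_assoc e2 e -comp_assoc m2.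
- move=> X m m' em1 em2; apply: (pb_eq H) => //.
  by rewrite -!comp_assoc em1.
Qed.

Lemma pb_vcomp (P2 P1 A2 A1 B D : C) (t1 : P1 ~> A1) (l1 : P1 ~> B) (f1 : A1 ~> D)
    (h : B ~> D) (t2 : P2 ~> A2) (l2 : P2 ~> P1) (f2 : A2 ~> A1) :
  is_pullback t1 l1 f1 h -> is_pullback t2 l2 f2 t1 ->
  is_pullback t2 (l1 ∘ l2) (f1 ∘ f2) h.
Proof. by move=> /pb_sym H1 /pb_sym H2; apply/pb_sym/(pb_hcomp H1 H2). Qed.

Lemma pb_vcancel (P2 P1 A2 A1 B D : C) (t1 : P1 ~> A1) (l1 : P1 ~> B) (f1 : A1 ~> D)
    (h : B ~> D) (t2 : P2 ~> A2) (l2 : P2 ~> P1) (f2 : A2 ~> A1) :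
  is_pullback t1 l1 f1 h -> f2 ∘ t2 = t1 ∘ l2 ->
  is_pullback t2 (l1 ∘ l2) (f1 ∘ f2) h -> is_pullback t2 l2 f2 t1.
Proof.
move=> /pb_sym H1 e /pb_sym H2.
by apply/pb_sym/(pb_hcancel H1 _ H2); rewrite e.
Qed.

(** Only two parallel sides are invertible. After [p], vertical morphisms become such sides, so base
    squares are pullbacks by this lemma, possibly after transposition. *)
Lemma pb_of_isos (P A B D : C) (t : P ~> A) (l : P ~> B) (f : A ~> D) (h : B ~> D) :
  is_iso t -> is_iso h -> f ∘ t = h ∘ l -> is_pullback t l f h.
Proof.
move=> it ih e; apply: pb_intro => //.
- have [t' [t1 t2]] := it.
  move=> X a b eab; exists (t' ∘ a); split; first by crw t2.
  by apply: (iso_mono ih); crwl e; crw t2.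
- by move=> X m m' /(iso_mono it).
Qed.

Lemma pb_iso (P A B D : C) (t : P ~> A) (l : P ~> B) (f : A ~> D) (h : B ~> D) :
  is_pullback t l f h -> is_iso f -> is_iso l.
Proof.
move=> H [f' [f1 f2]].
have [|m [m1 m2]] := pb_ex H (a := f' ∘ h) (b := idm B).
  by rewrite comp_assoc f2 comp_idl comp_idr.
exists m; split=> //; apply: (pb_eq H).
  by rewrite comp_assoc m1 -comp_assoc -(pb_comm H) comp_assoc f1 comp_idl comp_idr.
by rewrite comp_assoc m2 comp_idl comp_idr.
Qed.

Lemma pb_unique (P P' A B D : C) (t : P ~> A) (l : P ~> B) (t' : P' ~> A) (l' : P' ~> B)
    (f : A ~> D) (h : B ~> D) :
  is_pullback t l f h -> is_pullback t' l' f h ->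
  exists i : P ~> P', is_iso i /\ t' ∘ i = t /\ l' ∘ i = l.
Proof.
move=> H H'.
have [i [i1 i2]] := pb_ex H' (pb_comm H).
have [j [j1 j2]] := pb_ex H (pb_comm H').
exists i; split=> //; exists j; split.
- by apply: (pb_eq H); rewrite comp_idr comp_assoc ?j1 ?j2.
- by apply: (pb_eq H'); rewrite comp_idr comp_assoc ?i1 ?i2.
Qed.

Lemma pb_precomp_iso (P P' A B D : C) (t : P ~> A) (l : P ~> B) (f : A ~> D) (h : B ~> D)
    (i : P' ~> P) :
  is_iso i -> is_pullback t l f h -> is_pullback (t ∘ i) (l ∘ i) f h.
Proof.
move=> ii H; rewrite -{1}(comp_idr h); apply: (pb_hcomp H).
by apply: pb_of_isos => //; [exact: is_iso_id | rewrite comp_idl].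
Qed.

End Pullbacks.

Section Small.
Variables (C : Category) (Ut U : C) (u : Ut ~> U).

Lemma small_pb (P A B D : C) (t : P ~> A) (l : P ~> B) (f : A ~> D) (h : B ~> D) :
  is_pullback t l f h -> small u f -> small u l.
Proof.
move=> H [k [h' H']]; exists (k ∘ t), (h' ∘ h); exact: pb_hcomp H' H.
Qed.

Lemma small_precomp_iso (X' X Y : C) (f : X ~> Y) (i : X' ~> X) :
  is_iso i -> small u f -> small u (f ∘ i).
Proof.
move=> ii; apply: (@small_pb _ _ _ _ i _ _ (idm Y)).
by apply: pb_of_isos => //; [exact: is_iso_id | rewrite comp_idl].
Qed.

Lemma small_iso_square (X X' Y Y' : C) (f : X ~> Y) (f' : X' ~> Y') (i : X' ~> X)
    (j : Y' ~> Y) : is_iso i -> is_iso j -> f ∘ i = j ∘ f' -> small u f -> small u f'.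
Proof. by move=> ii ij e; apply: small_pb; apply: (pb_of_isos ii ij e). Qed.

Lemma small_trans (X Y X' Y' : C) (f : X ~> Y) (f' : X' ~> Y') :
  small f f' -> small u f -> small u f'.
Proof. by move=> [k [h H]]; apply: small_pb H. Qed.

End Small.

(** * Dependent products through their universal elements *)

Section UniversalDependentProducts.
Variable C : Category.

(* The representing form of a dependent product: [ev] is the universal element,
   living over the chosen pullback [Q] of [pi] along [g]. *)
Record is_udp (A B D P Q : C) (f : A ~> B) (g : B ~> D) (pi : P ~> D)
    (b : Q ~> B) (q : Q ~> P) (ev : Q ~> A) : Prop := {
  udp_pb : is_pullback b q g pi;
  udp_ev : f ∘ ev = b;
  udp_ex : forall (X Qx : C) (h : X ~> D) (bx : Qx ~> B) (qx : Qx ~> X),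
    is_pullback bx qx g h -> forall e : Qx ~> A, f ∘ e = bx ->
    exists (m : X ~> P) (r : Qx ~> Q), pi ∘ m = h /\ q ∘ r = m ∘ qx /\ ev ∘ r = e;
  udp_eq : forall (X Qx : C) (h : X ~> D) (bx : Qx ~> B) (qx : Qx ~> X),
    is_pullback bx qx g h -> forall (m m' : X ~> P) (r r' : Qx ~> Q),
    pi ∘ m = h -> pi ∘ m' = h -> q ∘ r = m ∘ qx -> q ∘ r' = m' ∘ qx ->
    b ∘ r = bx -> ev ∘ r = ev ∘ r' -> m = m' }.

Lemma slice_hom_eq (D X Y : C) (h : X ~> D) (k : Y ~> D) (m m' : SliceHom h k) :
  proj1_sig m = proj1_sig m' -> m = m'.
Proof.
case: m => m em; case: m' => m' em' /= e; subst m'.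
by rewrite (proof_irrelevance _ em em').
Qed.

Lemma inj_surj_bijective (S T : Type) (f : S -> T) :
  (forall x y, f x = f y -> x = y) -> (forall y, exists x, f x = y) -> bijective f.
Proof.
move=> inj sur.
pose g y := proj1_sig (constructive_indefinite_description _ (sur y)).
have gE y : f (g y) = y by rewrite /g; case: constructive_indefinite_description.
by exists g => // x; apply: inj.
Qed.

(** Yoneda: naturality writes every transpose as the transpose of the identity precomposed with the
    induced map of pullbacks, so bijectivity becomes existence and uniqueness. *)
Lemma udp_of_transposition (A B D P Q : C) (f : A ~> B) (g : B ~> D) (pi : P ~> D)
    (phi : Transposition f g pi) (b : Q ~> B) (q : Q ~> P) (sq : is_pullback b q g pi)
    (k : SliceHom pi pi) :
  is_natural_bijection phi -> proj1_sig k = idm P ->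
  is_udp f g pi b q (proj1_sig (phi P pi Q b q sq k)).
Proof.
move=> [bij nat] kE.
have key X h Qx (bx : Qx ~> B) (qx : Qx ~> X) (sx : is_pullback bx qx g h)
    (m : SliceHom h pi) (r : Qx ~> Q) : q ∘ r = proj1_sig m ∘ qx -> b ∘ r = bx ->
    proj1_sig (phi _ _ _ _ _ sx m) = proj1_sig (phi _ _ _ _ _ sq k) ∘ r.
  move=> e1 e2; apply: (nat _ _ _ _ _ _ _ _ _ _ _ _ (proj1_sig m)) => //.
    exact: (proj2_sig m).
  by rewrite kE comp_idl.
split=> //.
- exact: (proj2_sig (phi _ _ _ _ _ sq k)).
- move=> X Qx h bx qx sx e fe.
  have [psi _ can] := bij _ _ _ _ _ sx.
  pose m := psi (exist _ e fe); exists (proj1_sig m).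
  have [|r [r1 r2]] := pb_ex sq (a := bx) (b := proj1_sig m ∘ qx).
    by rewrite (pb_comm sx) comp_assoc (proj2_sig m).
  exists r; split; first exact: (proj2_sig m).
  by split=> //; rewrite -(key _ _ _ _ _ sx m) // can.
- move=> X Qx h bx qx sx m m' r r' em em' er er' br evr.
  have [psi can _] := bij _ _ _ _ _ sx.
  suff : exist _ m em = exist _ m' em' :> SliceHom h pi by case.
  rewrite -(can (exist _ m em)) -(can (exist _ m' em')); congr psi.
  apply: slice_hom_eq; rewrite (key _ _ _ _ _ sx _ r) // (key _ _ _ _ _ sx _ r') //.
  by rewrite -(proj2_sig (phi _ _ _ _ _ sq k)) -comp_assoc -evr comp_assoc
    (proj2_sig (phi _ _ _ _ _ sq k)).
Qed.

(** The clause on the identity keeps track of [ev]: preservation by [p] is stated for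
    transpositions, and [udp_fmap] must know what becomes of the universal element. *)
Lemma transposition_of_udp (A B D P Q : C) (f : A ~> B) (g : B ~> D) (pi : P ~> D)
    (b : Q ~> B) (q : Q ~> P) (ev : Q ~> A) :
  is_udp f g pi b q ev ->
  exists phi : Transposition f g pi, is_natural_bijection phi /\
    forall (sq : is_pullback b q g pi) (k : SliceHom pi pi), proj1_sig k = idm P ->
      proj1_sig (phi P pi Q b q sq k) = ev.
Proof.
move=> [sq evE ex uq].
have Hr X (h : X ~> D) Qx (bx : Qx ~> B) (qx : Qx ~> X) (sx : is_pullback bx qx g h)
    (k : SliceHom h pi) : exists r : Qx ~> Q, b ∘ r = bx /\ q ∘ r = proj1_sig k ∘ qx.
  by apply: (pb_ex sq); rewrite (pb_comm sx) comp_assoc (proj2_sig k).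
pose R X h Qx bx qx sx k :=
  constructive_indefinite_description _ (Hr X h Qx bx qx sx k).
have RE X h Qx bx qx sx k : f ∘ (ev ∘ proj1_sig (R X h Qx bx qx sx k)) = bx.
  by rewrite comp_assoc evE; case: (R _ _ _ _ _ _ _) => r [].
exists (fun X h Qx bx qx sx k => exist (fun m => f ∘ m = bx) _ (RE X h Qx bx qx sx k)).
split; last first.
  move=> sq' k kE /=; case: (R _ _ _ _ _ _ _) => r /= [r1 r2].
  have -> : r = idm Q; last by rewrite comp_idr.
  by apply: (pb_eq sq); rewrite comp_idr ?r1 ?r2 // kE comp_idl.
split.
- move=> X h Qx bx qx sx; apply: inj_surj_bijective.
    move=> k k' /(f_equal (@proj1_sig _ _)) /=.
    case: (R _ _ _ _ _ _ k) => r /= [r1 r2]; case: (R _ _ _ _ _ _ k') => r' /= [r1' r2'] er.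
    apply: slice_hom_eq; apply: (uq _ _ _ _ _ sx _ _ r r' (proj2_sig k) (proj2_sig k')) => //.
  move=> [e fe]; have [m [r [em [er evr]]]] := ex _ _ _ _ _ sx e fe.
  exists (exist _ m em); apply: slice_hom_eq => /=.
  case: (R _ _ _ _ _ _ _) => r' /= [r1 r2]; rewrite -evr; congr (_ ∘ _).
  apply: (pb_eq sq); last by rewrite r2 er.
  by rewrite r1 -evE -comp_assoc evr fe.
- move=> X h Qx bx qx sx X' h' Q' b' q' sx' t r ht qr br k kt ktE /=.
  case: (R _ _ _ _ _ _ _) => r1 /= [r11 r12]; case: (R _ _ _ _ _ _ _) => r2 /= [r21 r22].
  rewrite -comp_assoc; congr (_ ∘ _); apply: (pb_eq sq).
    by rewrite r11 comp_assoc r21 br.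
  by rewrite r12 ktE comp_assoc r22 -!comp_assoc qr.
Qed.

Lemma dependent_product_of_udp (A B D P Q : C) (f : A ~> B) (g : B ~> D) (pi : P ~> D)
    (b : Q ~> B) (q : Q ~> P) (ev : Q ~> A) :
  is_udp f g pi b q ev -> is_dependent_product f g pi.
Proof. by move=> /transposition_of_udp [phi [nat _]]; exists phi. Qed.

Lemma udp_of_dependent_product (A B D P Q : C) (f : A ~> B) (g : B ~> D) (pi : P ~> D)
    (b : Q ~> B) (q : Q ~> P) :
  is_pullback b q g pi -> is_dependent_product f g pi ->
  exists ev : Q ~> A, is_udp f g pi b q ev.
Proof.
move=> sq [phi nat].
pose k : SliceHom pi pi := exist _ (idm P) (comp_idr pi).
by exists (proj1_sig (phi P pi Q b q sq k)); apply: udp_of_transposition.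
Qed.

Lemma udp_unique (A B D P Q P' Q' : C) (f : A ~> B) (g : B ~> D) (pi : P ~> D)
    (b : Q ~> B) (q : Q ~> P) (ev : Q ~> A) (pi' : P' ~> D)
    (b' : Q' ~> B) (q' : Q' ~> P') (ev' : Q' ~> A) :
  is_udp f g pi b q ev -> is_udp f g pi' b' q' ev' ->
  exists i : P ~> P', is_iso i /\ pi' ∘ i = pi.
Proof.
move=> H H'.
have [m [r [m1 [m2 m3]]]] := udp_ex H' (udp_pb H) (udp_ev H).
have [n [s [n1 [n2 n3]]]] := udp_ex H (udp_pb H') (udp_ev H').
exists m; split=> //; exists n; split.
- apply: (udp_eq H (udp_pb H) (r := s ∘ r) (r' := idm Q)).
  + by rewrite comp_assoc n1.
  + by rewrite comp_idr.
  + by crw n2; crw m2.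
  + by rewrite comp_idl comp_idr.
  + by rewrite -(udp_ev H); crw n3; rewrite -comp_assoc m3.
  + by crw n3.
- apply: (udp_eq H' (udp_pb H') (r := r ∘ s) (r' := idm Q')).
  + by rewrite comp_assoc m1.
  + by rewrite comp_idr.
  + by crw m2; crw n2.
  + by rewrite comp_idl comp_idr.
  + by rewrite -(udp_ev H'); crw m3; rewrite -comp_assoc n3.
  + by crw m3.
Qed.

(** This is [Pi_(g2 g1) f = Pi_g2 (Pi_g1 f)], with [r1] the base change of [ev2] along [g1].
    Pullbacks along [g2] are assumed so that any pullback along [g2 ∘ g1] splits into two
    squares. *)
Lemma udp_comp (A B1 B D P1 Q1 P Q2 Q : C) (f : A ~> B) (g1 : B ~> B1) (g2 : B1 ~> D)
    (pi1 : P1 ~> B1) (b1 : Q1 ~> B) (q1 : Q1 ~> P1) (ev1 : Q1 ~> A)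
    (pi : P ~> D) (b2 : Q2 ~> B1) (q2 : Q2 ~> P) (ev2 : Q2 ~> P1)
    (b : Q ~> B) (q : Q ~> Q2) (r1 : Q ~> Q1) :
  (forall (X : C) (h : X ~> D), exists (Qx : C) (bx : Qx ~> B1) (qx : Qx ~> X),
     is_pullback bx qx g2 h) ->
  is_udp f g1 pi1 b1 q1 ev1 -> is_udp pi1 g2 pi b2 q2 ev2 ->
  is_pullback b q g1 b2 -> b1 ∘ r1 = b -> q1 ∘ r1 = ev2 ∘ q ->
  is_udp f (g2 ∘ g1) pi b (q2 ∘ q) (ev1 ∘ r1).
Proof.
move=> pbs H1 H2 Hq er1 er2.
have Hpb : is_pullback b (q2 ∘ q) (g2 ∘ g1) pi := pb_vcomp (udp_pb H2) Hq.
have fact X Qx (h : X ~> D) (bx : Qx ~> B) (qx : Qx ~> X) :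
    is_pullback bx qx (g2 ∘ g1) h -> exists (Qy : C) (by_ : Qy ~> B1) (qy : Qy ~> X) (s : Qx ~> Qy),
    is_pullback by_ qy g2 h /\ is_pullback bx s g1 by_ /\ qy ∘ s = qx.
  move=> Hx; have [Qy [by_ [qy Hy]]] := pbs X h.
  have [|s [s1 s2]] := pb_ex Hy (a := g1 ∘ bx) (b := qx).
    by rewrite comp_assoc (pb_comm Hx).
  exists Qy, by_, qy, s; split=> //; split=> //.
  by apply: (pb_vcancel Hy); rewrite ?s2 ?s1.
split=> //.
- by rewrite comp_assoc (udp_ev H1) er1.
- move=> X Qx h bx qx Hx e fe.
  have [Qy [by_ [qy [s [Hy [Hs es]]]]]] := fact _ _ _ _ _ Hx.
  have [m1 [s1 [em1 [es1 ev1E]]]] := udp_ex H1 Hs fe.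
  have [m [s2 [em [es2 ev2E]]]] := udp_ex H2 Hy em1.
  have [|t [t1 t2]] := pb_ex Hq (a := bx) (b := s2 ∘ s).
    rewrite -(udp_ev H2) comp_assoc; crw (pb_comm Hs).
    by rewrite -(comp_assoc pi1) ev2E em1.
  exists m, t; split=> //; split.
    by rewrite -comp_assoc t2 comp_assoc es2 -comp_assoc es.
  rewrite -ev1E -comp_assoc; congr (_ ∘ _); apply: (pb_eq (udp_pb H1)).
    by rewrite comp_assoc er1 t1 -(udp_ev H1) -comp_assoc ev1E fe.
  by rewrite comp_assoc er2 -comp_assoc t2 comp_assoc ev2E es1.
- move=> X Qx h bx qx Hx m m' t t' em em' et et' bt evt.
  have [Qy [by_ [qy [s [Hy [Hs es]]]]]] := fact _ _ _ _ _ Hx.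
  have lift n (tn : Qx ~> Q) : pi ∘ n = h -> q2 ∘ q ∘ tn = n ∘ qx -> b ∘ tn = bx ->
      exists s2 : Qy ~> Q2, b2 ∘ s2 = by_ /\ q2 ∘ s2 = n ∘ qy /\ s2 ∘ s = q ∘ tn.
    move=> en etn bn; have [|s2 [s21 s22]] := pb_ex (udp_pb H2) (a := by_) (b := n ∘ qy).
      by rewrite (pb_comm Hy) comp_assoc en.
    exists s2; split=> //; split=> //; apply: (pb_eq (udp_pb H2)).
      by rewrite comp_assoc s21 comp_assoc -(pb_comm Hq) -comp_assoc bn (pb_comm Hs).
    by rewrite comp_assoc s22 comp_assoc etn -comp_assoc es.
  have bt' : b ∘ t' = bx.
    rewrite -bt -er1 -(udp_ev H1); move: evt; rewrite -!comp_assoc => ->.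
    by rewrite !comp_assoc.
  have [s2 [s21 [s22 s23]]] := lift _ _ em et bt.
  have [s2' [s21' [s22' s23']]] := lift _ _ em' et' bt'.
  apply: (udp_eq H2 Hy em em' s22 s22' s21).
  apply: (udp_eq H1 Hs (r := r1 ∘ t) (r' := r1 ∘ t')).
  + by rewrite comp_assoc (udp_ev H2).
  + by rewrite comp_assoc (udp_ev H2).
  + by rewrite -(comp_assoc ev2) s23 comp_assoc er2 comp_assoc.
  + by rewrite -(comp_assoc ev2) s23' comp_assoc er2 comp_assoc.
  + by rewrite comp_assoc er1.
  + by rewrite !comp_assoc.
Qed.

End UniversalDependentProducts.

(** * Cartesian morphisms and fibers *)

Section Cartesian.
Variables (E B : Category) (p : Functor E B).

Lemma cart_ex (X Y : E) (f : X ~> Y) : is_cartesian p f ->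
  forall (Z : E) (g : Z ~> Y) (t : p Z ~> p X), fmap p f ∘ t = fmap p g ->
  exists h : Z ~> X, fmap p h = t /\ f ∘ h = g.
Proof. by move=> H Z g t /H [h [hE _]]; exists h. Qed.

Lemma cart_eq (X Y : E) (f : X ~> Y) : is_cartesian p f ->
  forall (Z : E) (h h' : Z ~> X), fmap p h = fmap p h' -> f ∘ h = f ∘ h' -> h = h'.
Proof.
move=> H Z h h' ep ef.
have [|k [_ ku]] := H Z (f ∘ h) (fmap p h); first by rewrite fmap_comp.
by rewrite -(ku h) // -(ku h').
Qed.

Lemma cart_intro (X Y : E) (f : X ~> Y) :
  (forall (Z : E) (g : Z ~> Y) (t : p Z ~> p X), fmap p f ∘ t = fmap p g ->
     exists h : Z ~> X, fmap p h = t /\ f ∘ h = g) ->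
  (forall (Z : E) (h h' : Z ~> X), fmap p h = fmap p h' -> f ∘ h = f ∘ h' -> h = h') ->
  is_cartesian p f.
Proof.
move=> ex uq Z g t /ex [h [h1 h2]]; exists h; split=> // h' [h1' h2'].
by apply: uq; [rewrite h1 h1' | rewrite h2 h2'].
Qed.

Lemma cart_iso (X Y : E) (f : X ~> Y) : is_iso f -> is_cartesian p f.
Proof.
move=> fi; have [f' [f1 f2]] := fi; apply: cart_intro.
- move=> Z g t e; exists (f' ∘ g); split; last by crw f2.
  apply: (iso_mono (fmap_iso p fi)).
  by rewrite -fmap_comp comp_assoc f2 comp_idl e.
- by move=> Z h h' _; apply: iso_mono.
Qed.

Lemma cart_comp (X Y Z : E) (g : Y ~> Z) (f : X ~> Y) :
  is_cartesian p g -> is_cartesian p f -> is_cartesian p (g ∘ f).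
Proof.
move=> Hg Hf; apply: cart_intro.
- move=> T h t; rewrite fmap_comp -comp_assoc => e.
  have [h1 [h11 h12]] := cart_ex Hg e.
  have [h2 [h21 h22]] := cart_ex Hf (Logic.eq_sym h11).
  by exists h2; split=> //; rewrite -comp_assoc h22.
- move=> T h h' e1 e2; apply: (cart_eq Hf) => //; apply: (cart_eq Hg).
    by rewrite !fmap_comp e1.
  by rewrite !comp_assoc.
Qed.

Lemma cart_cancel (X Y Z : E) (g : Y ~> Z) (f : X ~> Y) :
  is_cartesian p g -> is_cartesian p (g ∘ f) -> is_cartesian p f.
Proof.
move=> Hg Hgf; apply: cart_intro.
- move=> T h t e.
  have [|k [k1 k2]] := cart_ex Hgf (g := g ∘ h) (t := t).
    by rewrite !fmap_comp -e comp_assoc.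
  exists k; split=> //; apply: (cart_eq Hg); first by rewrite fmap_comp k1.
  by rewrite comp_assoc.
- move=> T h h' e1 e2; apply: (cart_eq Hgf) => //.
  by rewrite -!comp_assoc e2.
Qed.

Lemma iso_of_cart (X Y : E) (f : X ~> Y) :
  is_cartesian p f -> is_iso (fmap p f) -> is_iso f.
Proof.
move=> Hf [t [t1 t2]].
have [|g [g1 g2]] := cart_ex Hf (g := idm Y) (t := t); first by rewrite t2 fmap_id.
exists g; split=> //; apply: (cart_eq Hf); first by rewrite fmap_comp g1 t1 fmap_id.
by rewrite comp_assoc g2 comp_idl comp_idr.
Qed.

(** Mediating morphisms are found in the base, lifted through [c1], and compared after [c2]. *)
Lemma pb_of_cart (X' X Y' Y : E) (c1 : X' ~> X) (f' : X' ~> Y') (f : X ~> Y) (c2 : Y' ~> Y) :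
  is_cartesian p c1 -> is_cartesian p c2 -> f ∘ c1 = c2 ∘ f' ->
  is_pullback (fmap p c1) (fmap p f') (fmap p f) (fmap p c2) ->
  is_pullback c1 f' f c2.
Proof.
move=> H1 H2 e Hp; apply: pb_intro => //.
- move=> T a b eab.
  have [|m0 [m1 m2]] := pb_ex Hp (a := fmap p a) (b := fmap p b).
    by rewrite -!fmap_comp eab.
  have [m [em1 em2]] := cart_ex H1 m1.
  exists m; split=> //; apply: (cart_eq H2); first by rewrite fmap_comp em1.
  by rewrite comp_assoc -e -comp_assoc em2.
- move=> T m m' e1 e2; apply: (cart_eq H1) => //; apply: (pb_eq Hp).
    by rewrite -!fmap_comp e1.
  by rewrite -!fmap_comp e2.
Qed.

Lemma pb_cart (X' X Y' Y : E) (c1 : X' ~> X) (f' : X' ~> Y') (f : X ~> Y) (c2 : Y' ~> Y) :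
  is_pullback c1 f' f c2 ->
  is_pullback (fmap p c1) (fmap p f') (fmap p f) (fmap p c2) ->
  is_cartesian p c2 -> is_cartesian p c1.
Proof.
move=> H Hp H2; apply: cart_intro.
- move=> Z g t e.
  have [|b [b1 b2]] := cart_ex H2 (g := f ∘ g) (t := fmap p f' ∘ t).
    by crwl (pb_comm Hp); rewrite -comp_assoc e fmap_comp.
  have [m [m1 m2]] := pb_ex H (Logic.eq_sym b2).
  exists m; split=> //; apply: (pb_eq Hp); first by rewrite -fmap_comp m1 e.
  by rewrite -fmap_comp m2 b1.
- move=> Z h h' e1 e2; apply: (pb_eq H) => //; apply: (cart_eq H2).
    by rewrite !fmap_comp e1.
  by crwl (pb_comm H); rewrite -!comp_assoc e2.
Qed.

(* The equality [p X = I] as an isomorphism; it turns the heterogeneous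
   [above] into an equation between composites. *)
Definition iota (I : B) (X : FiberOb p I) : p (proj1_sig X) ~> I :=
  eq_rect _ (fun J => p (proj1_sig X) ~> J) (idm _) _ (proj2_sig X).

Lemma iota_iso (I : B) (X : FiberOb p I) : is_iso (iota X).
Proof. by destruct X as [X []]; apply: is_iso_id. Qed.

Lemma aboveE (I J : B) (X : FiberOb p I) (Y : FiberOb p J)
    (f : proj1_sig X ~> proj1_sig Y) (s : I ~> J) :
  above p f s <-> iota Y ∘ fmap p f = s ∘ iota X.
Proof.
case: X f => X eX; case: Y => Y eY /= f.
destruct eX, eY; rewrite /iota /= comp_idl comp_idr; split; first exact: arr_eq_same.
by move=> <-; apply: arr_refl.
Qed.

Lemma fiber_sval (I : B) (X Y : Fiber p I) (f g : X ~> Y) :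
  f = g -> proj1_sig f = proj1_sig g.
Proof. by move=> ->. Qed.

Lemma fiber_homE (I : B) (X Y : Fiber p I) (f : X ~> Y) :
  iota Y ∘ fmap p (proj1_sig f) = iota X.
Proof. by have /aboveE := proj2_sig f; rewrite comp_idl. Qed.

Lemma fiber_hom_intro (I : B) (X Y : Fiber p I) (f : proj1_sig X ~> proj1_sig Y) :
  iota Y ∘ fmap p f = iota X -> exists g : X ~> Y, proj1_sig g = f.
Proof.
move=> e; have H : above p f (idm I) by apply/aboveE; rewrite comp_idl.
by exists (exist _ f H).
Qed.

Lemma fiber_hom_iso (I : B) (X Y : Fiber p I) (f : X ~> Y) : is_iso (fmap p (proj1_sig f)).
Proof.
by apply: (is_iso_cancel_l (iota_iso Y)); rewrite fiber_homE; apply: iota_iso.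
Qed.

Lemma arr_eq_dom (C : Category) (X Y X' Y' : C) (f : X ~> Y) (f' : X' ~> Y') :
  arr_eq f f' -> X = X'.
Proof. by case. Qed.

Definition self_fiber (X : E) : Fiber p (p X) := exist _ X erefl.

Lemma fibred_lift_strict (Hp : is_fibred p) (I : B) (Y : E) (s : I ~> p Y) :
  exists (X : Fiber p I) (f : proj1_sig X ~> Y), s ∘ iota X = fmap p f /\ is_cartesian p f.
Proof.
have [X [f [fs fc]]] := Hp I Y s.
exists (exist _ X (arr_eq_dom fs)), f; split=> //.
have /(aboveE (X := exist _ X (arr_eq_dom fs)) (Y := self_fiber Y)) := fs.
by rewrite /= comp_idl.
Qed.

Lemma fibred_lift (Hp : is_fibred p) (I : B) (Y : E) (s : I ~> p Y) :
  exists (X : E) (f : X ~> Y) (i : p X ~> I),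
    is_iso i /\ s ∘ i = fmap p f /\ is_cartesian p f.
Proof.
have [X [f [fs fc]]] := fibred_lift_strict Hp s.
by exists (proj1_sig X), f, (iota X); split; [exact: (iota_iso X)|].
Qed.

(** Strict [above] data become equations between composites: the equality [p D = J] is replaced by
    the isomorphism [j]. *)
Lemma above_factor (A D C : E) (J : B) (s : p A ~> J) (t : J ~> p C) (c : D ~> C) (m : A ~> D) :
  above p c t -> above p m s ->
  exists j : p D ~> J, is_iso j /\ t ∘ j = fmap p c /\ j ∘ fmap p m = s.
Proof.
move=> ct ms; pose D' : Fiber p J := exist _ D (arr_eq_dom ct).
exists (iota D'); split; first exact: (iota_iso D'); split.
- have /(aboveE (X := D') (Y := self_fiber C)) := ct.
  by rewrite /= comp_idl.
- have /(aboveE (X := self_fiber A) (Y := D')) := ms.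
  by rewrite /= comp_idr.
Qed.

(** A cartesian lift of the inverse of [j] lies above an isomorphism, hence is one; its domain is a
    copy of [X] in the strict fibre. *)
Lemma strictify (Hp : is_fibred p) (I : B) (X : E) (j : p X ~> I) : is_iso j ->
  exists (X' : Fiber p I) (phi : proj1_sig X' ~> X), is_iso phi /\ j ∘ fmap p phi = iota X'.
Proof.
move=> [j' [j1 j2]].
have [X' [phi [e c]]] := fibred_lift_strict Hp j'.
exists X', phi; split; last by rewrite -e comp_assoc j2 comp_idl.
apply: iso_of_cart => //; rewrite -e; apply: is_iso_comp (iota_iso X').
by exists j.
Qed.

Lemma cart_factor (Hp : is_fibred p) (X Y : E) (f : X ~> Y) :
  exists (Y' : E) (d : Y' ~> Y) (f' : X ~> Y'),
    is_cartesian p d /\ is_iso (fmap p f') /\ d ∘ f' = f.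
Proof.
have [Y' [d [i [ii [e c]]]]] := fibred_lift Hp (fmap p f).
have [i' [i1 i2]] := ii.
have [|f' [f1 f2]] := cart_ex c (g := f) (t := i').
  by rewrite -e -comp_assoc i2 comp_idr.
by exists Y', d, f'; split=> //; split=> //; rewrite f1; exists i.
Qed.

Lemma fiber_pb_of_pb (I : B) (P A B' D : Fiber p I) (t : P ~> A) (l : P ~> B')
    (f : A ~> D) (h : B' ~> D) :
  is_pullback (proj1_sig t) (proj1_sig l) (proj1_sig f) (proj1_sig h) ->
  is_pullback t l f h.
Proof.
move=> H; apply: pb_intro.
- by apply: fiber_hom_eq => /=; apply: (pb_comm H).
- move=> X a b /fiber_sval /= e.
  have [m [m1 m2]] := pb_ex H e.
  have [|m' m'E] := fiber_hom_intro (X := X) (Y := P) (f := m).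
    by rewrite -(fiber_homE t) -comp_assoc -fmap_comp m1 fiber_homE.
  by exists m'; split; apply: fiber_hom_eq; rewrite /= m'E.
- move=> X m m' /fiber_sval /= e1 /fiber_sval /= e2.
  by apply: fiber_hom_eq; apply: (pb_eq H).
Qed.

Lemma fiber_iso (I : B) (X Y : Fiber p I) (f : X ~> Y) : is_iso f -> is_iso (proj1_sig f).
Proof.
move=> [g [/fiber_sval /= e1 /fiber_sval /= e2]].
by exists (proj1_sig g).
Qed.

Lemma reindexE (cl : Cleavage p) (I J : B) (s : I ~> J) (X Y : Fiber p J) (m : X ~> Y) :
  lift_map (cl I J s Y) ∘ proj1_sig (fmap (reindex cl s) m) =
  proj1_sig m ∘ lift_map (cl I J s X).
Proof. exact: (proj1 (proj2_sig (reindex_map_sig cl s m))). Qed.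

Lemma lift_mapE (cl : Cleavage p) (I J : B) (s : I ~> J) (Y : Fiber p J) :
  iota Y ∘ fmap p (lift_map (cl I J s Y)) = s ∘ iota (lift_ob (cl I J s Y)).
Proof. by apply/aboveE; apply: lift_above. Qed.

Lemma lift_map_cart (cl : Cleavage p) (I J : B) (s : I ~> J) (Y : Fiber p J) :
  is_cartesian p (lift_map (cl I J s Y)).
Proof. exact: lift_cartesian. Qed.

End Cartesian.

(** * Pullbacks, dependent products and acyclic cofibrations in fibres, compared with those of
    [E] *)

Section FibredTTFC.
Variables (E B : TTFC) (p : Functor E B).
Hypothesis Hp : is_fibred_TTFC p.

Let fibred := fttfc_fibred Hp.
Let tt := fttfc_functor Hp.

Lemma fmap_pb (P A B' D : E) (t : P ~> A) (l : P ~> B') (f : A ~> D) (h : B' ~> D) :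
  fib f -> is_pullback t l f h ->
  is_pullback (fmap p t) (fmap p l) (fmap p f) (fmap p h).
Proof. exact: ttf_pullback tt _ _ _ _ _ _ _ _. Qed.

Lemma fib_cart (X Y : E) (f : X ~> Y) : is_cartesian p f -> fib (fmap p f) -> fib f.
Proof. exact: fttfc_cartesian_fib Hp _ _ _. Qed.

(** The axiom on induced morphisms, with [s] and [t] taken to be the images of [m] and [c], so that
    no equality of objects intervenes. *)
Lemma fib_induced (A D C : E) (c : D ~> C) (m : A ~> D) :
  is_cartesian p c -> fib (c ∘ m) -> fib (fmap p m) -> fib m.
Proof.
move=> cc fg fm.
apply: (fttfc_induced Hp (g := c ∘ m) (s := fmap p m) (t := fmap p c) fg _ fm cc) => //.
by rewrite fmap_comp.
Qed.

Lemma pb_cart_top (X' X Y' Y : E) (c1 : X' ~> X) (f' : X' ~> Y') (f : X ~> Y) (c2 : Y' ~> Y) :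
  is_pullback c1 f' f c2 -> fib f -> is_cartesian p c2 -> is_cartesian p c1.
Proof. by move=> H ff; apply: (pb_cart H); apply: fmap_pb. Qed.

Lemma pb_cart_left (X' X Y' Y : E) (c1 : X' ~> Y') (f' : X' ~> X) (c2 : X ~> Y) (f : Y' ~> Y) :
  is_pullback f' c1 c2 f -> fib c2 -> is_cartesian p c2 -> is_cartesian p c1.
Proof. by move=> H ff; apply: (pb_cart (pb_sym H)); apply/pb_sym/fmap_pb. Qed.

(** The compatibility clause of [ttf_dependent_product] identifies [p ev] with the transpose of the
    identity under [psi], which is universal. *)
Lemma udp_fmap (A B' D P Q : E) (f : A ~> B') (g : B' ~> D) (pi : P ~> D)
    (b : Q ~> B') (q : Q ~> P) (ev : Q ~> A) :
  fib f -> fib g -> is_udp f g pi b q ev ->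
  is_udp (fmap p f) (fmap p g) (fmap p pi) (fmap p b) (fmap p q) (fmap p ev).
Proof.
move=> ff fg H.
have [phi [nat phiE]] := transposition_of_udp H.
have [psi [natp comm]] := ttf_dependent_product tt ff fg nat.
have sq := udp_pb H.
have Fsq : is_pullback (fmap p b) (fmap p q) (fmap p g) (fmap p pi) by apply: fmap_pb.
pose k : SliceHom pi pi := exist _ (idm P) (comp_idr pi).
pose Fk : SliceHom (fmap p pi) (fmap p pi) := exist _ (idm _) (comp_idr _).
have e : proj1_sig Fk = fmap p (proj1_sig k) by rewrite /= fmap_id.
rewrite -(phiE sq k) // -(comm _ _ _ _ _ _ Fsq _ _ e).
exact: udp_of_transposition.
Qed.

(** [p] preserves the pullback taken in [E] and inverts [f], so [l] is vertical again; the apex is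
    then moved into the strict fibre. *)
Lemma fiber_pb_exists (I : B) (A B' D : Fiber p I) (f : A ~> D) (h : B' ~> D) :
  fib (proj1_sig f) ->
  exists (P : Fiber p I) (t : P ~> A) (l : P ~> B'),
    is_pullback (proj1_sig t) (proj1_sig l) (proj1_sig f) (proj1_sig h).
Proof.
move=> ff; have [P [t [l H]]] := fib_pullback_exists (proj1_sig h) ff.
have li : is_iso (fmap p l) := pb_iso (fmap_pb ff H) (fiber_hom_iso f).
have [P' [phi [phii e]]] := strictify fibred (is_iso_comp (iota_iso B') li).
have [|l' l'E] := fiber_hom_intro (X := P') (Y := B') (f := l ∘ phi).
  by rewrite fmap_comp comp_assoc.
have [|t' t'E] := fiber_hom_intro (X := P') (Y := A) (f := t ∘ phi).
  rewrite -(fiber_homE f) -(fiber_homE l') l'E -(fiber_homE h).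
  by rewrite -!comp_assoc -!fmap_comp !comp_assoc (pb_comm H).
exists P', t', l'; rewrite t'E l'E; exact: pb_precomp_iso.
Qed.

Lemma pb_of_fiber_pb (I : B) (P A B' D : Fiber p I) (t : P ~> A) (l : P ~> B')
    (f : A ~> D) (h : B' ~> D) : fib (proj1_sig f) ->
  is_pullback t l f h ->
  is_pullback (proj1_sig t) (proj1_sig l) (proj1_sig f) (proj1_sig h).
Proof.
move=> ff H; have [P' [t' [l' H']]] := fiber_pb_exists h ff.
have [i [ii [it il]]] := pb_unique H (fiber_pb_of_pb H').
rewrite -it -il /=; apply: pb_precomp_iso H'; exact: fiber_iso.
Qed.

(** Pullbacks of [g] in the fibre are pullbacks in [E], and the mediating morphisms found in [E] are
    vertical because their composites with [pi] and [ev] are. *)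
Lemma fiber_dependent_product (I : B) (A B' D P : Fiber p I) (f : A ~> B') (g : B' ~> D)
    (pi : P ~> D) : fib (proj1_sig g) ->
  is_dependent_product (proj1_sig f) (proj1_sig g) (proj1_sig pi) ->
  is_dependent_product f g pi.
Proof.
move=> fg dp.
have [Q [b [q H]]] := fiber_pb_exists pi fg.
have [ev0 U] := udp_of_dependent_product H dp.
have [|ev evE] := fiber_hom_intro (X := Q) (Y := A) (f := ev0).
  by rewrite -(fiber_homE f) -comp_assoc -fmap_comp (udp_ev U) fiber_homE.
apply: (dependent_product_of_udp (b := b) (q := q) (ev := ev)); split.
- exact: fiber_pb_of_pb.
- by apply: fiber_hom_eq; rewrite /= evE (udp_ev U).
- move=> X Qx h bx qx /(pb_of_fiber_pb fg) Hx e /fiber_sval /= fe.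
  have [m0 [r0 [em [er eve]]]] := udp_ex U Hx fe.
  have [|m mE] := fiber_hom_intro (X := X) (Y := P) (f := m0).
    by rewrite -(fiber_homE pi) -comp_assoc -fmap_comp em fiber_homE.
  have [|r rE] := fiber_hom_intro (X := Qx) (Y := Q) (f := r0).
    by rewrite -(fiber_homE ev) -comp_assoc -fmap_comp evE eve fiber_homE.
  by exists m, r; split; [|split]; apply: fiber_hom_eq; rewrite /= ?mE ?rE ?evE.
- move=> X Qx h bx qx /(pb_of_fiber_pb fg) Hx m m' r r'.
  move=> /fiber_sval e1 /fiber_sval e2.
  move=> /fiber_sval e3 /fiber_sval e4.
  move=> /fiber_sval e5 /fiber_sval /= e6.
  apply: fiber_hom_eq; apply: (udp_eq U Hx e1 e2 e3 e4 e5).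
  by rewrite -evE.
Qed.

(* A lifting problem of [i : X ~> Y] against a fibration over [Y] is pulled
   back along the section [p f] of the base, which makes it vertical. *)
Lemma fiber_acyclic_cofibration (I : B) (X Y : Fiber p I) (i : X ~> Y) :
  acyclic_cofibration (fiber_fib p I) i ->
  acyclic_cofibration (@fib E) (proj1_sig i).
Proof.
move=> Hi C0 D0 q0 fq0 f0 g0 e0.
have [C [t0 [q Hq]]] := fib_pullback_exists g0 fq0.
have fq : fib q := fib_pullback fq0 Hq.
have [f [f1 f2]] := pb_ex Hq e0.
suff [h [h1 h2]] : exists h : proj1_sig Y ~> C, h ∘ proj1_sig i = f /\ q ∘ h = idm _.
  exists (t0 ∘ h); split; first by rewrite -comp_assoc h1.
  by rewrite comp_assoc (pb_comm Hq) -comp_assoc h2 comp_idr.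
have [D [d [q' [dc [q'i dq]]]]] := cart_factor fibred q.
have fq' : fib q'.
  by apply: fib_induced dc _ _; [rewrite dq | apply: fib_iso].
have [j [j1 j2]] := fiber_hom_iso i.
(* As [p i] is invertible, [f] yields a section of [p d], which lifts to a section [s] of [d]. The
   pullback of the vertical [q'] along [s] is then vertical over [Y]. *)
have [|s [s1 s2]] := cart_ex dc (g := idm (proj1_sig Y)) (t := fmap p (q' ∘ f) ∘ j).
  by rewrite comp_assoc -fmap_comp comp_assoc dq f2 j2 fmap_id.
have [P [t [l H]]] := fib_pullback_exists s fq'.
have fl : fib l := fib_pullback fq' H.
have [|m [m1 m2]] := pb_ex H (a := f) (b := proj1_sig i).
  apply: (cart_eq dc); first by rewrite fmap_comp fmap_comp s1 -comp_assoc j1 comp_idr fmap_comp.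
  by rewrite comp_assoc dq f2 comp_assoc s2 comp_idl.
have li : is_iso (fmap p l) := pb_iso (fmap_pb fq' H) q'i.
have [P' [phi [phii e]]] := strictify fibred (is_iso_comp (iota_iso Y) li).
have [phi' [p1 p2]] := phii.
have [|l' l'E] := fiber_hom_intro (X := P') (Y := Y) (f := l ∘ phi).
  by rewrite fmap_comp comp_assoc.
have lm : l ∘ phi ∘ (phi' ∘ m) = proj1_sig i by crw p2.
have [|m' m'E] := fiber_hom_intro (X := X) (Y := P') (f := phi' ∘ m).
  by rewrite -(fiber_homE l') -comp_assoc -fmap_comp l'E lm fiber_homE.
have fl' : fiber_fib p I P' Y l'.
  by rewrite /fiber_fib l'E; apply: fib_comp => //; apply: fib_iso.
have [|h [/fiber_sval /= h1 /fiber_sval /= h2]] :=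
    Hi _ _ l' fl' m' (idm Y).
  by rewrite comp_idl; apply: fiber_hom_eq; rewrite /= l'E m'E.
exists (t ∘ phi ∘ proj1_sig h); split.
  by rewrite -comp_assoc h1 m'E; crw p2.
have -> : q = d ∘ q' by [].
by crw (pb_comm H); rewrite s2 comp_idl -l'E.
Qed.

End FibredTTFC.

(** * Direct images and the Beck-Chevalley condition *)

(** Transposing the inverse of [f] over the identity of [D] gives a section [m] of [pi]. Since [f]
    is monic, evaluations agree automatically, so [m ∘ pi] is the identity. *)
Lemma udp_iso (C : Category) (A B D P Q : C) (f : A ~> B) (g : B ~> D) (pi : P ~> D)
    (b : Q ~> B) (q : Q ~> P) (ev : Q ~> A) :
  is_udp f g pi b q ev -> is_iso f -> is_iso pi.
Proof.
move=> H fi; have [f' [f1 f2]] := fi.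
have pbid : is_pullback (idm B) g g (idm D).
  by apply: pb_of_isos; [exact: is_iso_id | exact: is_iso_id | rewrite comp_idl comp_idr].
have [m [r [em [er evr]]]] := udp_ex H pbid f2.
exists m; split=> //.
have [|s [s1 s2]] := pb_ex (udp_pb H) (a := b) (b := m ∘ pi ∘ q).
  by crw em; rewrite (pb_comm (udp_pb H)).
apply: (udp_eq H (udp_pb H) (r := s) (r' := idm Q)).
- by crw em.
- by rewrite comp_idr.
- by [].
- by rewrite comp_idl comp_idr.
- by [].
- by apply: (iso_mono fi); rewrite !comp_assoc (udp_ev H) s1 comp_idr.
Qed.

Section Pushforward.
Variables (E B : Category) (p : Functor E B).

(* [W] is the direct image of [X] along the morphism under [c], with [ev] the
   counit [W' = c^*W ~> X]; the universal property also ranges over objects [Y]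
   above every base change [h], which is the Beck-Chevalley condition. *)
Record is_push (W' W X : E) (c : W' ~> W) (ev : W' ~> X) : Prop := {
  push_cart : is_cartesian p c;
  push_iso : is_iso (fmap p ev);
  push_ex : forall (Y' Y : E) (d : Y' ~> Y) (a : Y' ~> X) (h : p Y ~> p W) (k : p Y' ~> p W'),
    is_cartesian p d -> fmap p ev ∘ k = fmap p a -> is_pullback k (fmap p d) (fmap p c) h ->
    exists (b : Y ~> W) (b' : Y' ~> W'), fmap p b = h /\ c ∘ b' = b ∘ d /\ ev ∘ b' = a;
  push_eq : forall (Y' Y : E) (d : Y' ~> Y) (b1 b2 : Y ~> W) (b1' b2' : Y' ~> W'),
    is_cartesian p d -> is_pullback (fmap p b1') (fmap p d) (fmap p c) (fmap p b1) ->
    fmap p b1 = fmap p b2 -> c ∘ b1' = b1 ∘ d -> c ∘ b2' = b2 ∘ d -> ev ∘ b1' = ev ∘ b2' ->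
    b1 = b2 }.

End Pushforward.

Section PushforwardExistence.
Variables (E B : TTFC) (p : Functor E B).
Hypothesis Hp : is_fibred_TTFC p.

Let fibred := fttfc_fibred Hp.
Let tt := fttfc_functor Hp.

(** [T] is the terminal object of the fibre over [J], up to [i]. Since [bang E T] is cartesian, a
    map into [T] amounts to its image under [p]. *)
Lemma fiber_terminal (J : B) :
  exists (T : E) (i : p T ~> J), is_iso i /\ is_cartesian p (bang E T).
Proof.
have [s _] := ttf_one tt J.
have [T [f [i [ii [_ fc]]]]] := fibred_lift fibred s.
by exists T, i; rewrite -(bang_unique f).
Qed.

Lemma fiber_terminal_ex (T : E) : is_cartesian p (bang E T) ->
  forall (Y : E) (h : p Y ~> p T), exists m : Y ~> T, fmap p m = h.
Proof.
move=> Tc Y h.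
have e : fmap p (bang E T) ∘ h = fmap p (bang E Y).
  have [z [_ zu]] := ttf_one tt (p Y); by rewrite -(zu (fmap p (bang E Y))) // -(zu (_ ∘ h)).
by have [m [mE _]] := cart_ex Tc e; exists m.
Qed.

Lemma fiber_terminal_eq (T : E) : is_cartesian p (bang E T) ->
  forall (Y : E) (m m' : Y ~> T), fmap p m = fmap p m' -> m = m'.
Proof.
move=> Tc Y m m' e; apply: (cart_eq Tc) => //.
by rewrite (bang_unique (_ ∘ m)) (bang_unique (_ ∘ m')).
Qed.

(** The direct image is [Pi_sg x], where [x] maps [X] to the terminal object of its fibre and [sg]
    is the cartesian map of fibrewise terminal objects above [s]. Every base change is covered
    because a dependent product is tested on all maps [Y ~> TJ]. *)
Lemma push_exists (X : E) (J : B) (s : p X ~> J) : fib s ->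
  exists (W' W : E) (c : W' ~> W) (ev : W' ~> X) (j : p W ~> J),
    is_push p c ev /\ is_iso j /\ j ∘ fmap p c = s ∘ fmap p ev.
Proof.
move=> fs.
have [TX [iX [iXi TXc]]] := fiber_terminal (p X).
have [TJ [iJ [iJi TJc]]] := fiber_terminal J.
have [iX' [iX1 iX2]] := iXi; have [iJ' [iJ1 iJ2]] := iJi.
have [x xE] := fiber_terminal_ex TXc iX'.
have [sg sgE] := fiber_terminal_ex TJc (iJ' ∘ s ∘ iX).
have xi : is_iso (fmap p x) by rewrite xE; exists iX.
have fx : fib x.
  by apply: (fib_induced Hp TXc); [apply: fib_one | apply: fib_iso].
have sgc : is_cartesian p sg.
  by apply: (cart_cancel TJc); rewrite (bang_unique (_ ∘ sg)).
have fsg : fib sg.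
  apply: (fib_cart Hp) => //; rewrite sgE.
  apply: fib_comp; last exact: fib_iso.
  by apply: fib_comp => //; apply: fib_iso; exists iJ.
have [P [pi [fpi dp]]] := fib_dependent_product fx fsg.
have [Q [b [q sq]]] := fib_pullback_exists pi fsg.
have [ev U] := udp_of_dependent_product sq dp.
have psq := fmap_pb Hp fsg sq.
(* Under [p], [pi] becomes a dependent product of the isomorphism [p x], so [P] lies over [J] up to
   isomorphism. *)
have pii : is_iso (fmap p pi) := udp_iso (udp_fmap Hp fx fsg U) xi.
have qc : is_cartesian p q := pb_cart_left Hp sq fsg sgc.
have evE : fmap p x ∘ fmap p ev = fmap p b by rewrite -fmap_comp (udp_ev U).
exists Q, P, q, ev, (iJ ∘ fmap p pi); split; last split.
- split=> //.
  + apply: (is_iso_cancel_l xi); rewrite evE; exact: pb_iso (pb_sym psq) pii.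
  + move=> Y' Y d a h k dc ka Hk.
    (* [y] turns the base change [h] into a map of [E]; it makes [d] a pullback of [sg]. *)
    have [y yE] := fiber_terminal_ex TJc (fmap p pi ∘ h).
    have xaE : fmap p (x ∘ a) = fmap p b ∘ k.
      by rewrite fmap_comp -ka comp_assoc evE.
    have Hb : is_pullback (x ∘ a) d sg y.
      apply: pb_sym; apply: (pb_of_cart dc sgc).
        apply: (fiber_terminal_eq TJc).
        rewrite !(fmap_comp p y) !(fmap_comp p sg) xaE yE.
        by rewrite comp_assoc (pb_comm psq) -!comp_assoc (pb_comm Hk).
      by rewrite xaE yE; apply/pb_sym/(pb_hcomp psq Hk).
    have [m [r [m1 [m2 m3]]]] := udp_ex U Hb (erefl (x ∘ a)).
    exists m, r; split=> //; apply: (iso_mono pii).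
    by rewrite -fmap_comp m1.
  + move=> Y' Y d b1 b2 b1' b2' dc Hk e12 c1 c2 ev12.
    have Hb : is_pullback (b ∘ b1') d sg (pi ∘ b1).
      by apply: (pb_hcomp sq); apply: pb_sym; apply: (pb_of_cart dc qc) => //; apply: pb_sym.
    apply: (udp_eq U Hb (r := b1') (r' := b2')) => //.
    by apply: (fiber_terminal_eq TJc); rewrite !(fmap_comp p pi) e12.
- exact: is_iso_comp.
- rewrite -comp_assoc -(pb_comm psq) sgE -evE xE !comp_assoc iJ2 comp_idl.
  by crw iX2.
Qed.

(* The adjunction only sees objects of the fiber over [J], but it identifies
   [G X] with (a retract of) the direct image given by dependent products,
   whose universal property holds over every base. *)
Lemma push_adjunction (cl : Cleavage p) (I J : B) (s : I ~> J)
    (G : Functor (Fiber p I) (Fiber p J)) (adj : Adjunction (reindex cl s) G) (X : Fiber p I) :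
  fib s ->
  @is_push E B p _ _ _ (lift_map (cl I J s (G X))) (proj1_sig (adj_counit adj X)).
Proof.
move=> fs.
pose W := G X; pose L := cl I J s W; pose c := lift_map L.
pose W' := reindex cl s W; pose eps : W' ~> X := adj_counit adj X.
have cE : iota W ∘ fmap p c = s ∘ iota W' := lift_mapE cl s W.
have [|P' [P [cP [evP [j [PU [ji jE]]]]]]] := @push_exists (proj1_sig X) J (s ∘ iota X).
  by apply: fib_comp => //; apply: fib_iso; exact: (iota_iso X).
(* [F] is the direct image [P] moved into the strict fibre over [J], where the adjunction
   applies. *)
have [F [phi [[phi' [phi1 phi2]] phiE]]] := strictify fibred ji.
pose F' := reindex cl s F; pose cF := lift_map (cl I J s F).
have cFE : iota F ∘ fmap p cF = s ∘ iota F' := lift_mapE cl s F.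
have cFc : is_cartesian p cF := @lift_map_cart _ _ _ cl _ _ s F.
have Ri : is_iso (iota X ∘ fmap p evP) := is_iso_comp (iota_iso X) (push_iso PU).
have [R' [R1 R2]] := Ri.
(* [th] and [th'] compare [cF] and [cP], cartesian above the same morphism up to isomorphism. *)
have [|th [th1 th2]] := cart_ex (push_cart PU) (g := phi ∘ cF) (t := R' ∘ iota F').
  apply: (iso_mono ji); rewrite comp_assoc jE fmap_comp.
  rewrite !(comp_assoc j) phiE cFE -!comp_assoc; congr (_ ∘ _).
  by rewrite !comp_assoc R2 comp_idl.
have [iF' [iF1 iF2]] := iota_iso F'.
have [|th' [th'1 th'2]] := cart_ex cFc (g := phi' ∘ cP) (t := iF' ∘ iota X ∘ fmap p evP).
  apply: (iso_mono (iota_iso F)); rewrite !comp_assoc cFE; crw iF2.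
  rewrite -jE -phiE fmap_comp; crwl (fmap_comp p phi phi').
  by rewrite phi2 fmap_id comp_idr.
have thth : th ∘ th' = idm P'.
  apply: (cart_eq (push_cart PU)); last first.
    by rewrite comp_assoc th2 -comp_assoc th'2 comp_assoc phi2 comp_idl comp_idr.
  rewrite fmap_comp th1 th'1 !comp_assoc; crw iF2.
  by rewrite -comp_assoc R1 fmap_id.
have [|evF evFE] := fiber_hom_intro (X := F') (Y := X) (f := evP ∘ th).
  by rewrite fmap_comp th1 !comp_assoc R2 comp_idl.
(* [beta] is the adjoint transpose of [evF]. *)
have [beta betaE] : exists beta : F ~> W, eps ∘ fmap (reindex cl s) beta = evF.
  exists (fmap G evF ∘ adj_unit adj F); rewrite fmap_comp comp_assoc.
  rewrite /eps (adj_counit_natural adj evF).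
  by rewrite -comp_assoc (triangle_left adj) comp_idr.
have beta_lift : c ∘ proj1_sig (fmap (reindex cl s) beta) = proj1_sig beta ∘ cF :=
  reindexE cl s beta.
pose betaF := proj1_sig (fmap (reindex cl s) beta).
have betaF_ev : proj1_sig eps ∘ betaF = evP ∘ th by rewrite -evFE -betaE.
have [j' [j1 j2]] := ji; have [P'' [ev1 ev2]] := push_iso PU.
have epsi : is_iso (fmap p (proj1_sig eps)) := fiber_hom_iso eps.
(* In the other direction, the universal property of [P] applied to [eps] gives [ga : W ~> P]. *)
have [||ga [ga' [gaE [gac gaev]]]] := push_ex PU (d := c) (a := proj1_sig eps)
    (h := j' ∘ iota W) (k := P'' ∘ fmap p (proj1_sig eps)) (@lift_map_cart _ _ _ cl _ _ s W).
    by rewrite comp_assoc ev2 comp_idl.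
  { apply: pb_of_isos.
    - by apply: is_iso_comp => //; exists (fmap p evP).
    - by apply: is_iso_comp (iota_iso W); exists j.
    - apply: (iso_mono ji); rewrite !comp_assoc jE j2 comp_idl cE.
      by crw ev2; rewrite -(fiber_homE eps) comp_assoc. }
pose rho := proj1_sig beta ∘ phi'.
(* The vertical endomorphism [g] of [W] satisfies [eps ∘ s^* g = eps]; by naturality of the unit and
   a triangle identity it is the identity. *)
have retr : rho ∘ ga = idm (proj1_sig W).
  have [|g gE] := fiber_hom_intro (X := W) (Y := W) (f := rho ∘ ga).
    rewrite !fmap_comp !comp_assoc fiber_homE -phiE gaE -!comp_assoc.
    crwl (fmap_comp p phi phi'); rewrite phi2 fmap_id comp_idr.
    by rewrite j2 comp_idl.
  suff -> : rho ∘ ga = proj1_sig (idm W) by [].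
  rewrite -gE; apply: fiber_sval.
  have lift : proj1_sig (fmap (reindex cl s) g) = betaF ∘ th' ∘ ga'.
    apply: (cart_eq (@lift_map_cart _ _ _ cl _ _ s W)); last first.
      rewrite [LHS]reindexE gE !comp_assoc beta_lift; crw th'2.
      by rewrite -!comp_assoc gac.
    apply: (iso_mono (iota_iso W')).
    rewrite fiber_homE !fmap_comp !comp_assoc fiber_homE th'1 !comp_assoc iF2 comp_idl.
    by rewrite -comp_assoc -fmap_comp gaev fiber_homE.
  have epsg : eps ∘ fmap (reindex cl s) g = eps.
    apply: fiber_hom_eq => /=; move: lift => /= ->.
    rewrite !comp_assoc betaF_ev -(comp_assoc evP) thth comp_idr; exact: gaev.
  have : fmap G eps ∘ adj_unit adj W ∘ g = fmap G eps ∘ adj_unit adj W.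
    by rewrite -comp_assoc (adj_unit_natural adj g) comp_assoc -fmap_comp epsg.
  by rewrite /eps (triangle_right adj) comp_idl.
have pretr : fmap p rho ∘ (j' ∘ iota W) = idm _ by rewrite -gaE -fmap_comp retr fmap_id.
have ga_sq : is_pullback (fmap p ga') (fmap p c) (fmap p cP) (fmap p ga).
  apply: pb_of_isos; last by rewrite -!fmap_comp gac.
    by apply: (is_iso_cancel_l (push_iso PU)); rewrite -fmap_comp gaev.
  by rewrite gaE; apply: is_iso_comp (iota_iso W); exists j.
(* The universal property passes to the retract: solutions found in [P] are composed with [rho], and
   uniqueness is tested after [ga]. *)
split.
- exact: (@lift_map_cart _ _ _ cl _ _ s W).
- exact: epsi.
- move=> Y' Y d a h k dc ka Hk.
  have [||n [n' [nE [nc nev]]]] := push_ex PU (d := d) (a := a)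
    (h := fmap p ga ∘ h) (k := fmap p ga' ∘ k) dc.
      by rewrite comp_assoc -fmap_comp gaev; exact: ka.
    exact: pb_hcomp ga_sq Hk.
  exists (rho ∘ n), (betaF ∘ th' ∘ n'); split; last split.
  + by rewrite fmap_comp nE comp_assoc -fmap_comp retr fmap_id comp_idl.
  + rewrite -/c !comp_assoc beta_lift; crw th'2.
    by rewrite -!comp_assoc nc.
  + by rewrite -/eps !comp_assoc betaF_ev -(comp_assoc evP) thth comp_idr.
- move=> Y' Y d b1 b2 b1' b2' dc Hk e12 c1 c2 e.
  suff : ga ∘ b1 = ga ∘ b2.
    move=> /(f_equal (comp rho)); rewrite !comp_assoc retr.
    by rewrite (comp_idl b1) (comp_idl b2).
  apply: (push_eq PU (b1' := ga' ∘ b1') (b2' := ga' ∘ b2') dc).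
  + by rewrite !fmap_comp; exact: pb_hcomp ga_sq Hk.
  + by rewrite !fmap_comp e12.
  + by rewrite !comp_assoc gac -!comp_assoc c1.
  + by rewrite !comp_assoc gac -!comp_assoc c2.
  + by rewrite !comp_assoc gaev.
Qed.

End PushforwardExistence.

(** * The fibred universe *)

Section AcyclicCofibrations.
Variables (C : Category) (F : MorClass C).

Lemma acyclic_cofibration_iso (X Y : C) (i : X ~> Y) : is_iso i -> acyclic_cofibration F i.
Proof.
move=> [j [j1 j2]] Z T q fq f g e; exists (f ∘ j); split; first by crw j1.
by rewrite comp_assoc e; crw j2.
Qed.

Lemma acyclic_cofibration_comp (X Y Z : C) (j : Y ~> Z) (i : X ~> Y) :
  acyclic_cofibration F j -> acyclic_cofibration F i -> acyclic_cofibration F (j ∘ i).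
Proof.
move=> Hj Hi A B q fq f g; rewrite comp_assoc => e.
have [h [h1 h2]] := Hi _ _ _ fq _ _ e.
have [k [k1 k2]] := Hj _ _ _ fq _ _ h2.
by exists k; rewrite comp_assoc k1.
Qed.

End AcyclicCofibrations.

(** * Recognition of [w]-small morphisms and the axioms of a fibred universe *)

Section FibredUniverse.
Variables (E B : TTFC) (p : Functor E B).
Hypothesis Hp : is_fibred_TTFC p.
Variables (Vt0 V0 : E) (v0 : Vt0 ~> V0).
Hypothesis fib_v0 : fib v0.
Hypothesis v0_iso : is_iso (fmap p v0).
Hypothesis V0_terminal : is_terminal (p V0).

Let fibred := fttfc_fibred Hp.

Lemma small_fib (C : TTFC) (Ut U : C) (u : Ut ~> U) : fib u ->
  forall (X Y : C) (f : X ~> Y), small u f -> fib f.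
Proof. by move=> fu X Y f [k [h H]]; apply: fib_pullback fu H. Qed.

Lemma small_v0_iso (X Y : E) (f : X ~> Y) : small v0 f -> is_iso (fmap p f).
Proof. by move=> [k [h H]]; exact: pb_iso (fmap_pb Hp fib_v0 H) v0_iso. Qed.

Hypothesis v0_id : forall X : E, small v0 (idm X).
Hypothesis v0_comp : forall (X Y Z : E) (f : X ~> Y) (g : Y ~> Z),
  small v0 f -> small v0 g -> small v0 (g ∘ f).
Hypothesis v0_factorization : forall (A B' D : E) (a : A ~> D) (b : B' ~> D) (m : A ~> B'),
  small v0 a -> small v0 b -> b ∘ m = a ->
  exists (Z : E) (i : A ~> Z) (q : Z ~> B'),
    acyclic_cofibration (@fib E) i /\ small v0 q /\ q ∘ i = m.
Hypothesis v0_dependent_product :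
  forall (A B' D P : E) (f : A ~> B') (g : B' ~> D) (pi : P ~> D),
  small v0 f -> small v0 g -> is_dependent_product f g pi -> small v0 pi.

(** In the application [vU] is [v] reindexed to the domain of [u], [c] is the cartesian morphism
    above [u], [W] and [T] are the direct images of [X] and [Xt], [vs] is [u_* vU], and [eps],
    [epsT] are counits. *)
Variables (Xt X : E) (vU : Xt ~> X) (lt : Xt ~> Vt0) (l : X ~> V0).
Hypothesis l_cart : is_cartesian p l.
Hypothesis vU_pb : is_pullback lt vU v0 l.

Variables (W' W : E) (c : W' ~> W) (eps : W' ~> X).
Hypothesis W_push : is_push p c eps.

Variables (T' T : E) (cT : T' ~> T) (epsT : T' ~> Xt).
Hypothesis T_push : is_push p cT epsT.

Variables (vs : T ~> W) (vs' : T' ~> W').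
Hypothesis vs_comm : c ∘ vs' = vs ∘ cT.
Hypothesis vs_counit : eps ∘ vs' = vU ∘ epsT.
Hypothesis vs_small : small v0 vs.

Hypothesis base_universe : is_universe (@fib B) (fmap p c).

Variables (Wt : E) (top : Wt ~> Xt) (w' : Wt ~> W').
Hypothesis w'_pb : is_pullback top w' vU eps.

Let w := c ∘ w'.
Let c_cart := push_cart W_push.
Let eps_iso := push_iso W_push.

Lemma w'_small : small v0 w'.
Proof. by apply: small_pb w'_pb _; exists lt, l. Qed.

Let w'_iso := small_v0_iso w'_small.

Lemma fib_c : fib c.
Proof. exact: (fib_cart Hp c_cart (univ_fib base_universe)). Qed.

Lemma fib_w : fib w.
Proof. exact: fib_comp fib_c (small_fib fib_v0 w'_small). Qed.

(** [w'] is vertical, so [p w] and [p c] differ by the isomorphism [p w']; smallness in the base can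
    be tested on [p c]. *)
Lemma base_pb (I J : B) (s : I ~> J) (k : I ~> p Wt) (h : J ~> p W) :
  is_pullback k s (fmap p w) h -> is_pullback (fmap p w' ∘ k) s (fmap p c) h.
Proof.
move=> H; rewrite -(comp_idl h); apply: pb_hcomp H.
by apply: pb_of_isos => //; [exact: is_iso_id | rewrite /w fmap_comp comp_idl].
Qed.

Lemma base_smallE (I J : B) (s : I ~> J) : small (fmap p w) s <-> small (fmap p c) s.
Proof.
split; first by move=> [k [h H]]; exists (fmap p w' ∘ k), h; apply: base_pb.
move=> sc; apply: small_trans sc _.
have [w'' [w1 w2]] := w'_iso; exists w'', (idm _); apply: pb_of_isos.
- by exists (fmap p w').
- exact: is_iso_id.
- by rewrite /w fmap_comp -comp_assoc w2 comp_idl comp_idr.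
Qed.

(** As [p V0] is terminal, the classifying map of [f'] lifts through the cartesian [l] over any base
    map, here [p eps ∘ k]. The direct image turns this lift into a map [Y0 ~> W] above the
    prescribed [h]. *)
Lemma w_lift (Y0 X0 Y' : E) (d : Y' ~> Y0) (f' : X0 ~> Y')
    (k : p X0 ~> p W') (h : p Y0 ~> p W) :
  is_cartesian p d -> small v0 f' -> is_pullback k (fmap p (d ∘ f')) (fmap p c) h ->
  exists (hb : Y0 ~> W) (kb : X0 ~> Wt),
    fmap p hb = h /\ fmap p w' ∘ fmap p kb = k /\ is_pullback kb (d ∘ f') w hb.
Proof.
move=> dc Sf' H.
have [j [j1 j2]] := small_v0_iso Sf'.
have [k0 [h0 H0]] := Sf'.
have Hj : is_pullback (k ∘ j) (fmap p d) (fmap p c) h.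
  have -> : fmap p d = fmap p (d ∘ f') ∘ j by rewrite fmap_comp; crw j2.
  by apply: pb_precomp_iso => //; exists (fmap p f').
have [|a [a1 a2]] := cart_ex l_cart (g := h0) (t := fmap p eps ∘ (k ∘ j)).
  have [z [_ zu]] := V0_terminal (p Y').
  by rewrite -(zu (fmap p h0)) // -(zu (_ ∘ (_ ∘ _))).
have [|a' [a'1 a'2]] := pb_ex vU_pb (a := k0) (b := a ∘ f').
  by rewrite (pb_comm H0) comp_assoc a2.
have Ha : is_pullback a' f' vU a by apply: (pb_hcancel vU_pb) => //; rewrite a'1 a2.
have [b [b' [bE [b'1 b'2]]]] := push_ex W_push dc (Logic.eq_sym a1) Hj.
have pb' : fmap p b' = k ∘ j.
  by apply: (iso_mono eps_iso); rewrite -fmap_comp b'2.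
have [|kb [kb1 kb2]] := pb_ex w'_pb (a := a') (b := b' ∘ f').
  by rewrite a'2 comp_assoc b'2.
exists b, kb; split=> //; split.
  by rewrite -fmap_comp kb2 fmap_comp pb' -comp_assoc j1 comp_idr.
(* [d] is the pullback of [c] along [b], and [f'] that of [w'] along [b']; the two squares paste. *)
apply: (@pb_vcomp _ _ _ _ _ _ _ b' d c b).
- apply: pb_sym; apply: (pb_of_cart dc c_cart); first by rewrite b'1.
  by rewrite pb' bE; apply: pb_sym.
- by apply: (pb_hcancel w'_pb) => //; rewrite kb1 b'2.
Qed.

(** From right to left this is [w_lift]. Conversely, the base square lifts to a pullback of [c] with
    left side [d]; cancelling it exhibits [f'] as a pullback of [w']. *)
Lemma w_smallE (Y0 X0 Y' : E) (d : Y' ~> Y0) (f' : X0 ~> Y') :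
  is_cartesian p d -> is_iso (fmap p f') ->
  small w (d ∘ f') <-> small (fmap p c) (fmap p d) /\ small v0 f'.
Proof.
move=> dc f'i; have [j [j1 j2]] := f'i; split; last first.
  move=> [sd Sf'].
  have [k [h H]] : small (fmap p c) (fmap p (d ∘ f')).
    by rewrite fmap_comp; apply: small_precomp_iso.
  have [hb [kb [_ [_ H']]]] := w_lift dc Sf' H.
  by exists kb, hb.
move=> [kb [hb H]].
have Hw := base_pb (fmap_pb Hp fib_w H).
have dE : fmap p d = fmap p (d ∘ f') ∘ j by rewrite fmap_comp; crw j2.
have Hd : is_pullback (fmap p w' ∘ fmap p kb ∘ j) (fmap p d) (fmap p c) (fmap p hb).
  by rewrite dE; apply: pb_precomp_iso => //; exists (fmap p f').
split; first by exists (fmap p w' ∘ fmap p kb ∘ j), (fmap p hb).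
have [|b' [b'1 b'2]] := cart_ex c_cart (g := hb ∘ d) (t := fmap p w' ∘ fmap p kb ∘ j).
  by rewrite (pb_comm Hd) fmap_comp.
have Hb' : is_pullback b' d c hb.
  apply: pb_sym; apply: (pb_of_cart dc c_cart); first by rewrite b'2.
  by rewrite b'1; apply: pb_sym.
have e : w' ∘ kb = b' ∘ f'.
  apply: (cart_eq c_cart).
    by rewrite !fmap_comp b'1 -comp_assoc j1 comp_idr.
  by rewrite !comp_assoc b'2 (pb_comm H) comp_assoc.
by apply: small_pb (pb_vcancel Hb' e H) w'_small.
Qed.

Lemma w_small_cart (Y0 Y' : E) (d : Y' ~> Y0) :
  is_cartesian p d -> small (fmap p c) (fmap p d) -> small w d.
Proof.
move=> dc sd; rewrite -(comp_idr d); apply/w_smallE => //.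
by rewrite fmap_id; apply: is_iso_id.
Qed.

Lemma w_small_base (A D : E) (f : A ~> D) : small w f -> small (fmap p c) (fmap p f).
Proof.
move=> [k [h H]]; exists (fmap p w' ∘ fmap p k), (fmap p h).
exact: base_pb (fmap_pb Hp fib_w H).
Qed.

Lemma w_small_v0 (Y X0 : E) (f : X0 ~> Y) : small v0 f -> small w f.
Proof.
move=> Sf; rewrite -(comp_idl f); apply/w_smallE.
- exact/cart_iso/is_iso_id.
- exact: small_v0_iso.
- by rewrite fmap_id; split=> //; apply: (univ_id base_universe).
Qed.

Lemma w_comp (A B' D : E) (f : A ~> B') (g : B' ~> D) :
  small w f -> small w g -> small w (g ∘ f).
Proof.
have [A1 [df [f' [dfc [f'i fE]]]]] := cart_factor fibred f.
have [B1 [dg [g' [dgc [g'i gE]]]]] := cart_factor fibred g.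
rewrite -fE -gE => /(w_smallE dfc f'i) [sf Sf] /(w_smallE dgc g'i) [sg Sg].
(* The middle composite [g' ∘ df] is rewritten as [d2 ∘ g3], a vertical morphism followed by a
   cartesian one, with [g3] the pullback of [g'] along [d2]. *)
have [A2 [d2 [i [ii [iE d2c]]]]] := fibred_lift fibred (fmap p g' ∘ fmap p df).
have [i' [i1 i2]] := ii; have [g'' [g1 g2]] := g'i.
have [|g3 [g31 g32]] := cart_ex d2c (g := g' ∘ df) (t := i').
  by rewrite -iE -comp_assoc i2 comp_idr fmap_comp.
have g3i : is_iso (fmap p g3) by rewrite g31; exists i.
have H : is_pullback df g3 g' d2.
  apply: (pb_of_cart dfc d2c) => //; apply: pb_sym; apply: pb_of_isos => //.
  by rewrite -!fmap_comp g32.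
have e : dg ∘ g' ∘ (df ∘ f') = dg ∘ d2 ∘ (g3 ∘ f') by crw g32.
have dc : is_cartesian p (dg ∘ d2) by apply: cart_comp.
have gfi : is_iso (fmap p (g3 ∘ f')) by rewrite fmap_comp; apply: is_iso_comp.
rewrite e; apply/(w_smallE dc gfi); split.
- rewrite fmap_comp; apply: (univ_comp base_universe) => //.
  apply: (small_iso_square (j := g'') ii _ _ sf); first by exists (fmap p g').
  by rewrite -iE !comp_assoc g1 comp_idl.
- by apply: v0_comp => //; apply: small_pb H Sg.
Qed.

Lemma w_factorization (A B' D : E) (a : A ~> D) (b : B' ~> D) (m : A ~> B') :
  small w a -> small w b -> b ∘ m = a ->
  exists (Z : E) (i : A ~> Z) (q : Z ~> B'),
    acyclic_cofibration (@fib E) i /\ small w q /\ q ∘ i = m.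
Proof.
move=> sa sb bm.
have pbm : fmap p b ∘ fmap p m = fmap p a by rewrite -fmap_comp bm.
(* The factorization is made first in the base; the rest takes place above [Z0]. *)
have [Z0 [i0 [q0 [ai0 [sq0 q0i0]]]]] :=
  univ_factorization base_universe (w_small_base sa) (w_small_base sb) pbm.
have [B1 [e [b' [ec [b'i bE]]]]] := cart_factor fibred b.
have [A1 [ea [a' [eac [a'i aE]]]]] := cart_factor fibred a.
move: sa sb; rewrite -{1}bE -{1}aE => /(w_smallE eac a'i) [_ Sa'] /(w_smallE ec b'i) [_ Sb'].
(* [b2 : B2 ~> D1] will be [b'] reindexed along [q0]. *)
have [B2 [eB [jB [jBi [jBE eBc]]]]] := fibred_lift fibred q0.
have [D1 [eD [jD [jDi [jDE eDc]]]]] := fibred_lift fibred (fmap p b' ∘ q0).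
have [jB' [jB1 jB2]] := jBi; have [jD' [jD1 jD2]] := jDi.
have [a'' [a'1 a'2]] := a'i.
have ecc : is_cartesian p (e ∘ eD) by apply: cart_comp.
have [|b2 [b21 b22]] := cart_ex eDc (g := b' ∘ eB) (t := jD' ∘ jB).
  by rewrite -jDE fmap_comp -jBE !comp_assoc; crw jD2.
have b2i : is_iso (fmap p b2).
  by rewrite b21; apply: is_iso_comp => //; exists jD.
have Sb2 : small v0 b2.
  apply: (small_pb (t := eB) (f := b') (h := eD)) Sb'.
  apply: (pb_of_cart eBc eDc) => //; apply: pb_sym; apply: pb_of_isos => //.
  by rewrite -!fmap_comp b22.
(* [al] is cartesian and lies above [i0] up to isomorphisms, hence is an acyclic cofibration. *)
have [|al [al1 al2]] := cart_ex ecc (g := ea) (t := jD' ∘ i0 ∘ a'').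
  rewrite fmap_comp -jDE !comp_assoc; crw jD2; crw q0i0.
  by rewrite -!fmap_comp bE bm -aE fmap_comp -comp_assoc a'2 comp_idr.
have ala : acyclic_cofibration (@fib E) al.
  apply: (fttfc_cartesian_acyclic_cofibration Hp).
    by apply: (cart_cancel ecc); rewrite al2.
  rewrite al1; apply: acyclic_cofibration_comp; last first.
    by apply: acyclic_cofibration_iso; exists (fmap p a').
  apply: acyclic_cofibration_comp => //.
  by apply: acyclic_cofibration_iso; exists jD.
have [|m1 [m11 m12]] := cart_ex eBc (g := m) (t := jB' ∘ i0).
  by rewrite -jBE -q0i0 !comp_assoc; crw jB2.
have sqm : b2 ∘ m1 = al ∘ a'.
  apply: (cart_eq ecc).
    by rewrite !fmap_comp b21 m11 al1 !comp_assoc; crw jB2; crw a'1.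
  rewrite !comp_assoc al2 aE -bm -bE; crw b22.
  by rewrite -!comp_assoc m12.
have [k0 [h0 H0]] := Sa'.
(* [V0] is fibrant, so the classifying map of [a'] extends along [al]. *)
have [|h1 [h11 _]] := ala _ _ (bang E V0) (fib_one _) h0 (bang E D1).
  by rewrite (bang_unique (_ ∘ h0)) (bang_unique (_ ∘ al)).
have [A2 [k2 [a2 H2]]] := fib_pullback_exists h1 fib_v0.
have Sa2 : small v0 a2 by exists k2, h1.
have [|al' [al'1 al'2]] := pb_ex H2 (a := k0) (b := al ∘ a').
  by rewrite (pb_comm H0) comp_assoc h11.
have Ha2 : is_pullback al' a' a2 al.
  by apply: (pb_hcancel H2) => //; rewrite al'1 h11.
have fa2 : fib a2 := small_fib fib_v0 Sa2.
(* As a pullback of [al] along the fibration [a2], [al'] is again cartesian and above [i0] up to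
   isomorphisms. *)
have al'a : acyclic_cofibration (@fib E) al'.
  apply: (fttfc_cartesian_acyclic_cofibration Hp).
    by apply: (pb_cart_top Hp Ha2 fa2); apply: (cart_cancel ecc); rewrite al2.
  have [r [r1 r2]] := small_v0_iso Sa2.
  have -> : fmap p al' = r ∘ (jD' ∘ i0).
    apply: (iso_mono (small_v0_iso Sa2)); rewrite -fmap_comp al'2 fmap_comp al1.
    by rewrite !comp_assoc r2; crw a'1.
  apply: acyclic_cofibration_comp.
    by apply: acyclic_cofibration_iso; exists (fmap p a2).
  by apply: acyclic_cofibration_comp => //; apply: acyclic_cofibration_iso; exists jD.
(* Extending [m1] along [al'] gives [n : A2 ~> B2] over [D1], between [v0]-small morphisms, so it
   can be factored vertically. *)
have [|n [n1 n2]] := al'a _ _ b2 (small_fib fib_v0 Sb2) m1 a2.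
  by rewrite sqm al'2.
have [Z [i [q [ai [sq qi]]]]] := v0_factorization Sa2 Sb2 n2.
exists Z, (i ∘ al'), (eB ∘ q); split; first exact: acyclic_cofibration_comp.
split; last by crw qi; rewrite -comp_assoc n1.
apply/w_smallE => //; first exact: small_v0_iso.
by split=> //; rewrite -jBE; apply: small_precomp_iso.
Qed.

(* The dependent product of [f] along [d] is the pullback of [vs = u_* v] along
   the map [C0 ~> W] that classifies the base of [f]. *)
Lemma udp_cart (A B' C0 : E) (f : A ~> B') (d : B' ~> C0) :
  small v0 f -> is_cartesian p d -> small (fmap p c) (fmap p d) ->
  exists (P Q : E) (pi : P ~> C0) (b : Q ~> B') (q : Q ~> P) (ev : Q ~> A),
    is_udp f d pi b q ev /\ small v0 pi.
Proof.
move=> [k0 [h0 H0]] dc [k [h Hkh]].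
have fd : fib d.
  by apply: (fib_cart Hp dc); apply: (small_fib (univ_fib base_universe)); exists k, h.
(* [a] classifies [f] with base part [p eps ∘ k]; its transpose [b0 : C0 ~> W] is the map along
   which [vs] is pulled back. *)
have [|a [a1 a2]] := cart_ex l_cart (g := h0) (t := fmap p eps ∘ k).
  have [z [_ zu]] := V0_terminal (p B').
  by rewrite -(zu (fmap p h0)) // -(zu (_ ∘ (_ ∘ _))).
have [|a' [a'1 a'2]] := pb_ex vU_pb (a := k0) (b := a ∘ f).
  by rewrite (pb_comm H0) comp_assoc a2.
have Ha : is_pullback a' f vU a by apply: (pb_hcancel vU_pb) => //; rewrite a'1 a2.
have [b0 [b0' [b0E [b01 b02]]]] := push_ex W_push dc (Logic.eq_sym a1) Hkh.
have kE : fmap p b0' = k by apply: (iso_mono eps_iso); rewrite -fmap_comp b02.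
have fvs : fib vs := small_fib fib_v0 vs_small.
have [P [bt [pi HP]]] := fib_pullback_exists b0 fvs.
have Spi : small v0 pi := small_pb HP vs_small.
have [Q [b [q HQ]]] := fib_pullback_exists pi fd.
have vsi := small_v0_iso vs_small; have [y [y1 y2]] := vsi.
have vUi : is_iso (fmap p vU) := pb_iso (fmap_pb Hp fib_v0 vU_pb) v0_iso.
have vs'i : is_iso (fmap p vs').
  apply: (is_iso_cancel_l eps_iso); rewrite -fmap_comp vs_counit fmap_comp.
  exact: is_iso_comp vUi (push_iso T_push).
have [z [z1 z2]] := vs'i.
have cT_cart := push_cart T_push.
have T_mono Y (x x' : Y ~> T') : fmap p vs' ∘ fmap p x = fmap p vs' ∘ fmap p x' ->
    cT ∘ x = cT ∘ x' -> x = x'.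
  by move=> e1 e2; apply: (cart_eq cT_cart) => //; apply: (iso_mono vs'i).
(* [y] and [z] invert [p vs] and [p vs']; through them [p cT] is identified with [p c]. *)
have cTE : fmap p cT ∘ z = y ∘ fmap p c.
  apply: (iso_mono vsi); rewrite !comp_assoc -fmap_comp -vs_comm fmap_comp y2 comp_idl.
  by crw z2.
(* [t] lifts [bt ∘ q] to [T']; composed with the counit [epsT] it provides the evaluation [ev]. *)
have [|t [t1 t2]] := cart_ex cT_cart (g := bt ∘ q) (t := z ∘ fmap p b0' ∘ fmap p b).
  rewrite !comp_assoc cTE; apply: (iso_mono vsi); rewrite !comp_assoc y2 comp_idl -!fmap_comp.
  by rewrite comp_assoc (pb_comm HP) b01; crw (pb_comm HQ).
have vt : vs' ∘ t = b0' ∘ b.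
  apply: (cart_eq c_cart).
    by rewrite !fmap_comp t1 !comp_assoc z2 comp_idl.
  rewrite !comp_assoc vs_comm b01 -comp_assoc t2 comp_assoc (pb_comm HP).
  by crw (pb_comm HQ).
have [|ev [ev1 ev2]] := pb_ex Ha (a := epsT ∘ t) (b := b).
  by rewrite comp_assoc -vs_counit -comp_assoc vt comp_assoc b02.
exists P, Q, pi, b, q, ev; split=> //; split=> //.
- move=> Y Qx h' bx qx Hx e fe.
  have qxc : is_cartesian p qx := pb_cart_left Hp Hx fd dc.
  have pHx := fmap_pb Hp fd Hx.
  have HT : is_pullback (z ∘ fmap p (b0' ∘ bx)) (fmap p qx) (fmap p cT) (y ∘ fmap p (b0 ∘ h')).
    apply: (@pb_hcomp _ _ _ _ _ _ _ z (fmap p c)).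
      apply: pb_of_isos => //; [by exists (fmap p vs') | by exists (fmap p vs)].
    by rewrite !fmap_comp kE b0E; apply: pb_hcomp pHx.
  have aE : fmap p epsT ∘ (z ∘ fmap p (b0' ∘ bx)) = fmap p (a' ∘ e).
    apply: (iso_mono vUi); rewrite !comp_assoc -!fmap_comp -vs_counit !fmap_comp.
    crw z2; rewrite -!fmap_comp ?comp_assoc b02 a'2.
    by rewrite -!comp_assoc fe.
  (* [n] is the transpose of [a' ∘ e] into [T]. Uniqueness for [W] gives [vs ∘ n = b0 ∘ h'], so [n]
     factors through [P]. *)
  have [n [n' [nE [n1 n2]]]] := push_ex T_push qxc aE HT.
  have n'E : fmap p n' = z ∘ fmap p (b0' ∘ bx).
    by apply: (iso_mono (push_iso T_push)); rewrite -fmap_comp n2 aE.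
  have vn : vs ∘ n = b0 ∘ h'.
  { apply: (push_eq W_push (b1' := vs' ∘ n') (b2' := b0' ∘ bx) qxc).
    + rewrite fmap_comp n'E comp_assoc z2 comp_idl fmap_comp kE fmap_comp nE comp_assoc y2.
      by rewrite comp_idl fmap_comp b0E; apply: pb_hcomp pHx.
    + by rewrite fmap_comp nE comp_assoc y2 comp_idl.
    + by rewrite comp_assoc vs_comm -comp_assoc n1 comp_assoc.
    + by rewrite comp_assoc b01 -comp_assoc (pb_comm Hx) comp_assoc.
    + rewrite !comp_assoc vs_counit b02 -comp_assoc n2 comp_assoc a'2.
      by rewrite -comp_assoc fe. }
  have [m [m1 m2]] := pb_ex HP vn.
  have [|r [r1 r2]] := pb_ex HQ (a := bx) (b := m ∘ qx).
    by rewrite comp_assoc m2 (pb_comm Hx).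
  exists m, r; split=> //; split=> //.
  apply: (pb_eq Ha); last by rewrite comp_assoc ev2 r1 fe.
  rewrite comp_assoc ev1 -n2 -comp_assoc; congr (_ ∘ _).
  apply: T_mono.
    by rewrite -!fmap_comp comp_assoc vt -comp_assoc r1 [RHS]fmap_comp n'E comp_assoc z2 comp_idl.
  by rewrite comp_assoc t2 -comp_assoc r2 comp_assoc m1 n1.
- move=> Y Qx h' bx qx Hx m m' r r' em em' er er' br evr.
  have qxc : is_cartesian p qx := pb_cart_left Hp Hx fd dc.
  have pHx := fmap_pb Hp fd Hx.
  have vm n : pi ∘ n = h' -> vs ∘ (bt ∘ n) = b0 ∘ h'.
    by move=> <-; rewrite comp_assoc (pb_comm HP) comp_assoc.
  have pm n : pi ∘ n = h' -> fmap p (bt ∘ n) = y ∘ fmap p (b0 ∘ h').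
    by move=> en; apply: (iso_mono vsi); rewrite -fmap_comp (vm _ en) comp_assoc y2 comp_idl.
  apply: (pb_eq HP); last by rewrite em em'.
  apply: (push_eq T_push (b1' := t ∘ r) (b2' := t ∘ r') qxc).
  + rewrite (pm _ em) fmap_comp t1 -!comp_assoc -!fmap_comp br.
    apply: (@pb_hcomp _ _ _ _ _ _ _ z (fmap p c)).
      apply: pb_of_isos => //; [by exists (fmap p vs') | by exists (fmap p vs)].
    by rewrite !fmap_comp kE b0E; apply: pb_hcomp pHx.
  + by rewrite !pm.
  + by rewrite comp_assoc t2 -!comp_assoc er.
  + by rewrite comp_assoc t2 -!comp_assoc er'.
  + by rewrite !comp_assoc -ev1 -!comp_assoc evr.
Qed.

(** With [g = d ∘ g'], [Pi_g f] is [Pi_d (Pi_g' f)]: the inner product is small by the fibrewise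
    closure, the outer one by [udp_cart], and uniqueness transfers this to [pi]. *)
Lemma v0_dependent_product_along_w (A B' D P : E) (f : A ~> B') (g : B' ~> D) (pi : P ~> D) :
  small v0 f -> small w g -> is_dependent_product f g pi -> small v0 pi.
Proof.
move=> Sf sg dp.
have [B1 [d [g' [dc [g'i gE]]]]] := cart_factor fibred g.
have [sd Sg'] : small (fmap p c) (fmap p d) /\ small v0 g'.
  by apply/(w_smallE dc g'i); rewrite gE.
have fg' : fib g' := small_fib fib_v0 Sg'.
have fd : fib d := fib_cart Hp dc (small_fib (univ_fib base_universe) sd).
have [P1 [pi1 [fpi1 dp1]]] := fib_dependent_product (small_fib fib_v0 Sf) fg'.
have Spi1 := v0_dependent_product Sf Sg' dp1.
have [Q1 [b1 [q1 H1]]] := fib_pullback_exists pi1 fg'.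
have [ev1 U1] := udp_of_dependent_product H1 dp1.
have [P2 [Q2 [pi2 [b2 [q2 [ev2 [U2 Spi2]]]]]]] := udp_cart Spi1 dc sd.
have [Q [b [q HQ]]] := fib_pullback_exists b2 fg'.
have [|r1 [r11 r12]] := pb_ex H1 (a := b) (b := ev2 ∘ q).
  by rewrite (pb_comm HQ) comp_assoc (udp_ev U2).
have pbs Y (h : Y ~> D) : exists (Qx : E) (bx : Qx ~> B1) (qx : Qx ~> Y), is_pullback bx qx d h.
  exact: fib_pullback_exists.
have U := udp_comp pbs U1 U2 HQ r11 r12.
rewrite gE in U.
have [Q0 [b0 [q0 H0]]] := fib_pullback_exists pi (small_fib fib_w sg).
have [ev0 U0] := udp_of_dependent_product H0 dp.
have [i [ii iE]] := udp_unique U0 U.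
by rewrite -iE; apply: small_precomp_iso.
Qed.

(* Over [P1], the base change of [D] along [p pi], [pi] is the dependent product
   of the base change of the vertical part of [f] along [p ev]. *)
Lemma w_dependent_product (A B' D P : E) (f : A ~> B') (g : B' ~> D) (pi : P ~> D) :
  small w f -> small w g -> is_dependent_product f g pi -> small w pi.
Proof.
move=> sf sg dp.
have ff : fib f := small_fib fib_w sf.
have fg : fib g := small_fib fib_w sg.
have [Q [b [q H]]] := fib_pullback_exists pi fg.
have [ev U] := udp_of_dependent_product H dp.
have pU := udp_fmap Hp ff fg U.
have spi : small (fmap p c) (fmap p pi).
  apply: (univ_dependent_product base_universe (w_small_base sf) (w_small_base sg)).
  exact: dependent_product_of_udp pU.
have [A1 [e [f' [ec [f'i fE]]]]] := cart_factor fibred f.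
have [_ Sf'] : small (fmap p c) (fmap p e) /\ small v0 f'.
  by apply/(w_smallE ec f'i); rewrite fE.
have [P1 [d [pi' [dc [pi'i piE]]]]] := cart_factor fibred pi.
have [j [j1 j2]] := pi'i.
have [Q1 [b1 [q1 H1]]] := fib_pullback_exists d fg.
have pH1 := fmap_pb Hp fg H1.
have b1c : is_cartesian p b1 := pb_cart_top Hp H1 fg dc.
(* [s] is a base change of [pi'], hence vertical, so the base part of [ev] can be carried from [Q]
   to [Q1]. *)
have [|s [s1 s2]] := pb_ex H1 (a := b) (b := pi' ∘ q).
  by rewrite comp_assoc piE (pb_comm H).
have Hs : is_pullback s q q1 pi' by apply: (pb_hcancel H1); rewrite ?s1 ?piE.
have fq1 : fib q1 := fib_pullback fg H1.
have si : is_iso (fmap p s) := pb_iso (pb_sym (fmap_pb Hp fq1 Hs)) pi'i.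
have [s' [s'1 s'2]] := si.
(* [b1'] lifts [b1] through [e] with the base part of [ev]; [f2] is the pullback of [f'] along
   it. *)
have [|b1' [b1'1 b1'2]] := cart_ex ec (g := b1) (t := fmap p f' ∘ fmap p ev ∘ s').
  rewrite !comp_assoc -!fmap_comp fE (udp_ev U) -s1 fmap_comp -comp_assoc s'2.
  by rewrite comp_idr.
have ff' : fib f' := small_fib fib_v0 Sf'.
have [A2 [tp [f2 H2]]] := fib_pullback_exists b1' ff'.
have Sf2 : small v0 f2 := small_pb H2 Sf'.
have b1's : b1' ∘ s = f' ∘ ev.
  apply: (cart_eq ec).
    by rewrite !fmap_comp b1'1 -comp_assoc s'1 comp_idr.
  by rewrite !comp_assoc b1'2 s1 fE (udp_ev U).
have [|ev2 [ev21 ev22]] := pb_ex H2 (a := ev) (b := s); first by rewrite b1's.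
have U' : is_udp f2 q1 pi' s q ev2.
{ split=> //.
  - move=> X0 Qx h1 bx1 qx Hx e2 fe2.
    have HX : is_pullback (b1 ∘ bx1) qx g (d ∘ h1) := pb_hcomp H1 Hx.
    have fe : f ∘ (tp ∘ e2) = b1 ∘ bx1.
      rewrite -fE; crw (pb_comm H2); rewrite b1'2; crw fe2.
      by [].
    have [m [r [m1 [m2 m3]]]] := udp_ex U HX fe.
    have br : b ∘ r = b1 ∘ bx1 by rewrite -(udp_ev U) -comp_assoc m3.
    (* Uniqueness for the dependent product in the base determines [p m], which forces
       [pi' ∘ m = h1]. *)
    have pm : fmap p m = j ∘ fmap p h1.
    { apply: (udp_eq pU (fmap_pb Hp fg HX) (r := fmap p r) (r' := s' ∘ fmap p bx1)).
      + by rewrite -fmap_comp m1.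
      + by rewrite -piE !fmap_comp; crw j2.
      + by rewrite -!fmap_comp m2.
      + apply: (iso_mono pi'i); rewrite !comp_assoc j2 comp_idl -!fmap_comp -(pb_comm Hx).
        by rewrite -(pb_comm Hs) !fmap_comp; crw s'2.
      + by rewrite -fmap_comp br.
      + apply: (iso_mono f'i); rewrite -fmap_comp m3 -fmap_comp comp_assoc (pb_comm H2).
        by rewrite -comp_assoc fe2 fmap_comp b1'1 !comp_assoc. }
    have mh : pi' ∘ m = h1.
      apply: (cart_eq dc); first by rewrite fmap_comp pm comp_assoc j2 comp_idl.
      by rewrite comp_assoc piE.
    have sr : s ∘ r = bx1.
      apply: (pb_eq H1); first by rewrite comp_assoc s1.
      by rewrite comp_assoc (pb_comm Hs) -comp_assoc m2 comp_assoc mh (pb_comm Hx).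
    exists m, r; split=> //; split=> //.
    apply: (pb_eq H2); first by rewrite comp_assoc ev21.
    by rewrite comp_assoc ev22 sr.
  - move=> X0 Qx h1 bx1 qx Hx m m' r r' em em' er er' br evr.
    apply: (udp_eq U (pb_hcomp H1 Hx) (r := r) (r' := r')) => //.
    + by rewrite -piE -comp_assoc em.
    + by rewrite -piE -comp_assoc em'.
    + by rewrite -s1 -comp_assoc br.
    + by rewrite -ev21 -!comp_assoc evr. }
have sq1 : small w q1 := small_pb H1 sg.
have Spi' := v0_dependent_product_along_w Sf2 sq1 (dependent_product_of_udp U').
rewrite -piE; apply/(w_smallE dc pi'i); split=> //.
have -> : fmap p d = fmap p pi ∘ j by rewrite -piE fmap_comp; crw j2.
by apply: small_precomp_iso => //; exists (fmap p pi').
Qed.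

Lemma w_fibred_universe : is_universe (@fib B) (fmap p w) -> is_fibred_universe p w.
Proof.
move=> pw_universe; split=> //.
- exact: fib_w.
- split.
  + exact: fib_w.
  + by move=> A; apply: w_small_v0.
  + exact: w_comp.
  + exact: w_dependent_product.
  + exact: w_factorization.
- move=> X0 Y0 f sf h k H.
  have [Y1 [d [f' [dc [f'i fE]]]]] := cart_factor fibred f.
  move: sf H; rewrite -fE => /(w_smallE dc f'i) [_ Sf'] /base_pb H.
  have [hb [kb [hE [kE H']]]] := w_lift dc Sf' H.
  by exists hb, kb; split=> //; split=> //; apply: (iso_mono w'_iso).
- by move=> X0 Y0 f fc /base_smallE; apply: w_small_cart.
- move=> A C g J s t sg /base_smallE ss ts D d m dc dt ms dm.
  have [j [ji [tj jm]]] := above_factor dt ms.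
  have [D1 [d1 [m' [d1c [m'i mE]]]]] := cart_factor fibred m.
  (* [m] and [g] share the vertical part [m'], small because [g] is; the cartesian part [d1] is
     controlled by [s]. *)
  have gE : g = d ∘ d1 ∘ m' by rewrite -dm -mE comp_assoc.
  rewrite gE in sg.
  have [_ Sm'] : _ /\ _ := proj1 (w_smallE (cart_comp dc d1c) m'i) sg.
  rewrite -mE; apply/(w_smallE d1c m'i); split=> //.
  have sm : small (fmap p c) (fmap p m).
    by apply: small_iso_square (is_iso_id _) ji _ ss; rewrite comp_idr.
  have [n [n1 n2]] := m'i.
  have -> : fmap p d1 = fmap p m ∘ n by rewrite -mE fmap_comp; crw n2.
  by apply: small_precomp_iso => //; exists (fmap p m').
Qed.

End FibredUniverse.

(** * From strict fibers to vertical morphisms *)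

Lemma udp_transport (C : Category) (A B D P Q A' B' P' : C) (f : A ~> B) (g : B ~> D)
    (pi : P ~> D) (b : Q ~> B) (q : Q ~> P) (ev : Q ~> A)
    (f' : A' ~> B') (a : A' ~> A) (i : B' ~> B) (j : P' ~> P)
    (a' : A ~> A') (i' : B ~> B') (j' : P ~> P') :
  a' ∘ a = idm _ -> a ∘ a' = idm _ -> i' ∘ i = idm _ -> i ∘ i' = idm _ ->
  j' ∘ j = idm _ -> j ∘ j' = idm _ -> i ∘ f' = f ∘ a ->
  is_udp f g pi b q ev ->
  is_udp f' (g ∘ i) (pi ∘ j) (i' ∘ b) (j' ∘ q) (a' ∘ ev).
Proof.
move=> a1 a2 i1 i2 j1 j2 e U.
have f'E : f' = i' ∘ f ∘ a by rewrite -comp_assoc -e comp_assoc i1 comp_idl.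
have back Y (h : Y ~> D) Qx (bx : Qx ~> B') (qx : Qx ~> Y) :
    is_pullback bx qx (g ∘ i) h -> is_pullback (i ∘ bx) qx g h.
  move=> H; rewrite -(comp_idl h); apply: pb_hcomp H.
  by apply: pb_of_isos; [exists i' | exact: is_iso_id | rewrite comp_idl].
split.
- apply: pb_intro.
  + by crw i2; crw j2; rewrite (pb_comm (udp_pb U)).
  + move=> X x y exy.
    have [|m [m1 m2]] := pb_ex (udp_pb U) (a := i ∘ x) (b := j ∘ y).
      by rewrite !comp_assoc.
    by exists m; rewrite -!comp_assoc m1 m2 !comp_assoc i1 j1 !comp_idl.
  + move=> X m m' e1 e2; apply: (pb_eq (udp_pb U)).
      by move: (f_equal (comp i) e1); rewrite !comp_assoc i2 !comp_idl.
    by move: (f_equal (comp j) e2); rewrite !comp_assoc j2 !comp_idl.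
- by rewrite f'E; crw a2; rewrite -comp_assoc (udp_ev U).
- move=> X Qx h bx qx /back H e0 fe0.
  have [|m [r [m1 [m2 m3]]]] := udp_ex U H (e := a ∘ e0).
    by rewrite -fe0 !comp_assoc e.
  exists (j' ∘ m), r; split; first by crw j2.
  by rewrite -!comp_assoc m2 m3 !comp_assoc a1 comp_idl.
- move=> X Qx h bx qx /back H m m' r r' em em' er er' br evr.
  suff e0 : j ∘ m = j ∘ m'.
    by move: (f_equal (comp j') e0); rewrite !comp_assoc j1 !comp_idl.
  apply: (udp_eq U H (r := r) (r' := r')).
  + by rewrite comp_assoc.
  + by rewrite comp_assoc.
  + by rewrite -comp_assoc -er !comp_assoc j2 comp_idl.
  + by rewrite -comp_assoc -er' !comp_assoc j2 comp_idl.
  + by rewrite -br !comp_assoc i2 comp_idl.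
  + by move: (f_equal (comp a) evr); rewrite !comp_assoc a2 !comp_idl.
Qed.

(** The image under [p] of a morphism above [u] has endpoints only propositionally equal to those of
    [u], so the universe property moves along [arr_eq]. *)
Lemma is_universe_arr_eq (C : TTFC) (X Y X' Y' : C) (f : X ~> Y) (f' : X' ~> Y') :
  arr_eq f f' -> is_universe (@fib C) f' -> is_universe (@fib C) f.
Proof. by case. Qed.

(** * From the universes [v_ I] to closure properties of [v0]-small morphisms in [E] *)

Section VerticalSmall.
Variables (E B : TTFC) (p : Functor E B).
Hypothesis Hp : is_fibred_TTFC p.
Variable cl : Cleavage p.
Variables (Vt V : Fiber p (one B)) (v : Vt ~> V).
Hypothesis fib_v : fib (proj1_sig v).

Let fibred := fttfc_fibred Hp.
Let v0 := proj1_sig v.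
Let v_ (I : B) := fmap (reindex cl (bang B I)) v.
Hypothesis v_universe : forall I : B, is_universe (fiber_fib p I) (v_ I).

Lemma fiber_one_eq (X : Fiber p (one B)) (I : B) (s s' : I ~> p (proj1_sig X)) : s = s'.
Proof.
by apply: (iso_mono (iota_iso X)); rewrite (bang_unique (_ ∘ s)) (bang_unique (_ ∘ s')).
Qed.

Lemma fiber_one_terminal (X : Fiber p (one B)) : is_terminal (p (proj1_sig X)).
Proof.
move=> I; have [j _] := iota_iso X.
by exists (j ∘ bang B I); split=> // s _; apply: fiber_one_eq.
Qed.

Lemma reindex_pb (I J : B) (s : I ~> J) (X Y : Fiber p J) (m : X ~> Y) :
  is_pullback (lift_map (cl s X)) (proj1_sig (fmap (reindex cl s) m))
    (proj1_sig m) (lift_map (cl s Y)).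
Proof.
apply: (pb_of_cart (@lift_map_cart _ _ _ cl _ _ s X) (@lift_map_cart _ _ _ cl _ _ s Y)).
  by rewrite reindexE.
apply: pb_sym; apply: pb_of_isos; [exact: fiber_hom_iso | exact: fiber_hom_iso |].
by rewrite -!fmap_comp reindexE.
Qed.

(** One morphism [v0] of [E] replaces the family [v_ I]. From right to left, the classifying map
    lifts through the cartesian morphism into [V] with a base part that makes it vertical; the base
    equation holds since [p V] is terminal. *)
Lemma fiber_smallE (I : B) (X Y : Fiber p I) (f : X ~> Y) :
  small (v_ I) f <-> small v0 (proj1_sig f).
Proof.
have sq := reindex_pb (bang B I) v; split.
  move=> [k [h H]]; apply: small_pb (pb_of_fiber_pb Hp (univ_fib (v_universe I)) H) _.
  by exists (lift_map (cl (bang B I) Vt)), (lift_map (cl (bang B I) V)).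
move=> [k [h H]].
pose VI := reindex cl (bang B I) V; pose VtI := reindex cl (bang B I) Vt.
have [j [j1 j2]] := iota_iso VI.
have [|h' [h'1 h'2]] := cart_ex (@lift_map_cart _ _ _ cl _ _ (bang B I) V)
    (g := h) (t := j ∘ iota Y); first exact: fiber_one_eq.
have [|k' [k'1 k'2]] := pb_ex sq (a := k) (b := h' ∘ proj1_sig f).
  by rewrite comp_assoc h'2 (pb_comm H).
have [|hf hfE] := fiber_hom_intro (X := Y) (Y := VI) (f := h').
  by rewrite h'1 comp_assoc j2 comp_idl.
have [|kf kfE] := fiber_hom_intro (X := X) (Y := VtI) (f := k').
  rewrite -(fiber_homE (v_ I)) -comp_assoc -fmap_comp k'2 -hfE fmap_comp comp_assoc.
  by rewrite !fiber_homE.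
exists kf, hf; apply: fiber_pb_of_pb; rewrite kfE hfE.
by apply: (pb_hcancel sq k'2); rewrite k'1 h'2.
Qed.

(** Starting from a strict copy [Y'] of the codomain lets composable vertical morphisms be made
    strict successively, with matching objects. *)
Lemma vertical_replacement (I : B) (Y' : Fiber p I) (X Y : E) (f : X ~> Y)
    (j : proj1_sig Y' ~> Y) : is_iso j -> is_iso (fmap p f) ->
  exists (X' : Fiber p I) (i : proj1_sig X' ~> X) (f' : X' ~> Y'),
    is_iso i /\ j ∘ proj1_sig f' = f ∘ i.
Proof.
move=> [j' [j1 j2]] fi.
have [|X' [i [ii iE]]] := strictify fibred (j := iota Y' ∘ fmap p (j' ∘ f)).
  apply: (is_iso_comp (iota_iso Y')); rewrite fmap_comp; apply: is_iso_comp => //.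
  by apply: fmap_iso; exists j.
have [|f' f'E] := fiber_hom_intro (X := X') (Y := Y') (f := j' ∘ f ∘ i).
  by rewrite fmap_comp comp_assoc.
by exists X', i, f'; rewrite f'E !comp_assoc j2 comp_idl.
Qed.

Lemma small_v_iso (X Y : E) (f : X ~> Y) : small v0 f -> is_iso (fmap p f).
Proof. exact: (small_v0_iso Hp fib_v (fiber_hom_iso v)). Qed.

Lemma small_v_id (X : E) : small v0 (idm X).
Proof.
by have /fiber_smallE := univ_id (v_universe (p X)) (self_fiber p X).
Qed.

Lemma small_v_comp (X Y Z : E) (f : X ~> Y) (g : Y ~> Z) :
  small v0 f -> small v0 g -> small v0 (g ∘ f).
Proof.
move=> sf sg.
have [Y' [j [g' [ji gE]]]] :=
  vertical_replacement (Y' := self_fiber p Z) (is_iso_id _) (small_v_iso sg).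
have [X' [i [f' [ii fE]]]] := vertical_replacement ji (small_v_iso sf).
rewrite comp_idl in gE.
have sg' : small v0 (proj1_sig g') by rewrite gE; apply: small_precomp_iso.
have sf' : small v0 (proj1_sig f') by apply: small_iso_square ii ji _ sf.
have /fiber_smallE /= := univ_comp (v_universe _) (proj2 (fiber_smallE _) sf')
  (proj2 (fiber_smallE _) sg').
have [i' [i1 i2]] := ii.
rewrite gE -comp_assoc fE => /(small_precomp_iso (i := i')) H.
by move: (H (ex_intro _ i (conj i2 i1))); rewrite !comp_assoc; crw i2.
Qed.

(** The morphisms are moved to the fibre over [p D] and factored there; a fibrewise acyclic
    cofibration is one in [E]. *)
Lemma small_v_factorization (A B' D : E) (a : A ~> D) (b : B' ~> D) (m : A ~> B') :
  small v0 a -> small v0 b -> b ∘ m = a ->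
  exists (Z : E) (i : A ~> Z) (q : Z ~> B'),
    acyclic_cofibration (@fib E) i /\ small v0 q /\ q ∘ i = m.
Proof.
move=> sa sb bm.
have [A1 [i [a1 [ii aE]]]] :=
  vertical_replacement (Y' := self_fiber p D) (is_iso_id _) (small_v_iso sa).
have [B1 [j [b1 [ji bE]]]] :=
  vertical_replacement (Y' := self_fiber p D) (is_iso_id _) (small_v_iso sb).
rewrite comp_idl in aE; rewrite comp_idl in bE.
have [i' [i1 i2]] := ii; have [j' [j1 j2]] := ji.
have bmE : proj1_sig b1 ∘ (j' ∘ m ∘ i) = proj1_sig a1.
  by rewrite bE aE !comp_assoc; crw j2; rewrite bm.
have [|m1 m1E] := fiber_hom_intro (X := A1) (Y := B1) (f := j' ∘ m ∘ i).
  by rewrite -(fiber_homE b1) -comp_assoc -fmap_comp bmE fiber_homE.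
have sa1 : small (v_ _) a1 by apply/fiber_smallE; rewrite aE; apply: small_precomp_iso.
have sb1 : small (v_ _) b1 by apply/fiber_smallE; rewrite bE; apply: small_precomp_iso.
have [|Z [k [q [ak [sq /fiber_sval /= qk]]]]] :=
    univ_factorization (v_universe _) (m := m1) sa1 sb1.
  by apply: fiber_hom_eq; rewrite /= m1E.
exists (proj1_sig Z), (proj1_sig k ∘ i'), (j ∘ proj1_sig q); split; last split.
- apply: acyclic_cofibration_comp; first exact: (fiber_acyclic_cofibration Hp ak).
  by apply: acyclic_cofibration_iso; exists i.
- apply: (small_iso_square (j := j') (is_iso_id _) _ _ (proj1 (fiber_smallE _) sq)).
    by exists j.
  by rewrite comp_idr comp_assoc j1 comp_idl.
- by crw qk; rewrite m1E !comp_assoc j2 comp_idl -comp_assoc i2 comp_idr.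
Qed.

(** [pi] is vertical because [p] preserves dependent products, so all the data move to the fibre
    over [p D]. *)
Lemma small_v_dependent_product (A B' D P : E) (f : A ~> B') (g : B' ~> D) (pi : P ~> D) :
  small v0 f -> small v0 g -> is_dependent_product f g pi -> small v0 pi.
Proof.
move=> sf sg dp.
have ff := small_fib fib_v sf; have fg := small_fib fib_v sg.
have [Q [b [q H]]] := fib_pullback_exists pi fg.
have [ev U] := udp_of_dependent_product H dp.
have pii : is_iso (fmap p pi) := udp_iso (udp_fmap Hp ff fg U) (small_v_iso sf).
have [B1 [i [g1 [ii gE]]]] :=
  vertical_replacement (Y' := self_fiber p D) (is_iso_id _) (small_v_iso sg).
have [P1 [j [pi1 [ji piE]]]] :=
  vertical_replacement (Y' := self_fiber p D) (is_iso_id _) pii.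
have [A1 [a [f1 [ai fE]]]] := vertical_replacement ii (small_v_iso sf).
rewrite comp_idl in gE; rewrite comp_idl in piE.
have sf1 : small v0 (proj1_sig f1) by apply: small_iso_square ai ii _ sf.
have sg1 : small v0 (proj1_sig g1) by rewrite gE; apply: small_precomp_iso.
have [i' [i1 i2]] := ii; have [j' [j1 j2]] := ji; have [a' [a1 a2]] := ai.
have := dependent_product_of_udp (udp_transport a1 a2 i1 i2 j1 j2 fE U).
rewrite -gE -piE => /(fiber_dependent_product Hp (small_fib fib_v sg1)) dp1.
have /fiber_smallE := univ_dependent_product (v_universe _) (proj2 (fiber_smallE _) sf1)
  (proj2 (fiber_smallE _) sg1) dp1.
rewrite piE => /(small_precomp_iso (i := j')) K.
by move: (K (ex_intro _ j (conj j2 j1))); crw j2.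
Qed.

End VerticalSmall.

(** * Assembly of the fibred universe from the adjunction *)

Theorem mainTheorem6 (E B : TTFC) (p : Functor E B) (Hp : is_fibred_TTFC p)
    (cl : Cleavage p)
    (Ut U : B) (u : Ut ~> U) (Hu : fib u)
    (Vt V : Fiber p (one B)) (v : Vt ~> V) (Hv : fiber_fib p (one B) Vt V v)
    (u_star : Functor (Fiber p Ut) (Fiber p U))
    (adj : Adjunction (reindex cl u) u_star) :
  let V_ (I : B) : Fiber p I := reindex cl (bang B I) V in
  let Vt_ (I : B) : Fiber p I := reindex cl (bang B I) Vt in
  let v_ (I : B) : Vt_ I ~> V_ I := fmap (reindex cl (bang B I)) v in
  is_universe (@fib B) u ->
  (forall I : B, is_universe (fiber_fib p I) (v_ I)) ->
  small (v_ U) (fmap u_star (v_ Ut)) ->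
  let W : Fiber p U := u_star (V_ Ut) in
  let eps : reindex cl u W ~> V_ Ut := adj_counit adj (V_ Ut) in
  (exists (Wt : Fiber p Ut) (top : Wt ~> Vt_ Ut) (w' : Wt ~> reindex cl u W),
     is_pullback top w' (v_ Ut) eps) /\
  (forall (Wt : Fiber p Ut) (top : Wt ~> Vt_ Ut) (w' : Wt ~> reindex cl u W),
     is_pullback top w' (v_ Ut) eps ->
     let w : proj1_sig Wt ~> proj1_sig W := lift_map (cl Ut U u W) ∘ proj1_sig w' in
     is_fibred_universe p w /\ above p w u).
Proof.
move=> V_ Vt_ v_ Uu Uv Hs W eps.
have fvU : fib (proj1_sig (v_ Ut)) := univ_fib (Uv Ut).
split.
  have [Wt [top [w' H]]] := fiber_pb_exists Hp eps fvU.
  by exists Wt, top, w'; apply: fiber_pb_of_pb.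
move=> Wt top w' H w.
have wu : above p w u.
  have := fiber_comp_above (lift_above (cl Ut U u W)) (proj2_sig w').
  by rewrite comp_idr.
split=> //.
pose vs := fmap u_star (v_ Ut).
(* The direct-image property is used at both [V_ Ut] and [Vt_ Ut]; naturality of the counit relates
   the two along [vs]. *)
apply: (@w_fibred_universe E B p Hp _ _ (proj1_sig v) Hv (fiber_hom_iso v)
  (fiber_one_terminal V)
  (small_v_id Hp Uv) (small_v_comp Hp Hv Uv)
  (small_v_factorization Hp Hv Uv) (small_v_dependent_product Hp Hv Uv)
  _ _ _ _ _ (@lift_map_cart _ _ _ cl _ _ (bang B Ut) V)
  (reindex_pb cl (bang B Ut) v) _ _ _ _ (push_adjunction Hp adj (V_ Ut) Hu)
  _ _ _ _ (push_adjunction Hp adj (Vt_ Ut) Hu) (proj1_sig vs)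
  (proj1_sig (fmap (reindex cl u) vs))).
- exact: reindexE.
- exact: (fiber_sval (adj_counit_natural adj (v_ Ut))).
- exact/(fiber_smallE Hp Uv).
- exact: is_universe_arr_eq (lift_above (cl Ut U u W)) Uu.
- exact: (pb_of_fiber_pb Hp fvU H).
- exact: is_universe_arr_eq wu Uu.
Qed.
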